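(* Let $S$ be a set, and let $H \colon S \to \mathbb{R}_{>0}$ be a map such that for any $B \in \mathbb{R}_{>0}$ one has $N(S,H,B):= \#\{x \in S : H(x) \le B\} < \infty$. Define $Z(S,H,s)=\sum_{x \in S} H(x)^{-s}$, and assume that it converges absolutely for complex numbers $s$ with sufficiently large real parts and that there exists $\alpha \in \mathbb{R}_{>0}$ such that $Z(S,H,s) \in \mathbb{Q}(\alpha^{-s})$. Let $\mathrm{Poles}$ be the set of poles of $Z(S,H,s)$ defined by $$\mathrm{Poles} = \left\{a \in \mathbb{C} : a \text{ is a pole of } Z(S,H,s),\ 0 \le \mathrm{Re}(a),\ 0 \le \mathrm{Im}(a) < \frac{2\pi}{\log \alpha} \right\}.$$ For a pole $a \in \mathrm{Poles}$, write the Laurent expansion at $s = a$ as $$Z(S,H,s) = \sum_{n=1}^{N_a} \frac{c_n(a)}{(\log \alpha)^n(s - a)^n} + (\text{holomorphic at } s=a).$$ Then the following asymptotic formula for $N(S,H,B)$ holds as $B\to\infty$: $$N(S, H, B) = \sum_{\alpha^m \le B}\ \sum_{a \in \mathrm{Poles}} \alpha^{am} \sum_{n = 1}^{N_a} c_{n}(a) \frac{m^{n-1}}{(n - 1)!} + O(1),$$ where the outer sum runs over integers $m\ge 0$ with $\alpha^m\le B$.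
   Context: Here $\mathbb{R}_{>0}$ is the set of positive real numbers. The condition $Z(S,H,s)\in\mathbb{Q}(\alpha^{-s})$ means that $Z(S,H,s)$ is a rational function of $\alpha^{-s}$ with rational coefficients; $Z(S,H,s)$ then also denotes the resulting meromorphic function on $\mathbb{C}$, and poles and Laurent expansions refer to this function. Powers $\alpha^{am}$ mean $e^{am\log\alpha}$ with real $\log\alpha$, and $m^{n-1}$ is read as $1$ when $n=1$ (including $m=0$).
   Formalization: The condition α ∈ ℝ_{>0} is strengthened to α > 1: for α = 1 the bound 2π/log α is undefined, and for α < 1 the set Poles is empty and the formula fails (e.g. S = ℕ, H(k) = 2^k, α = 1/2). *)

(* Defs.v *)
From HB Require Import structures.
From mathcomp Require Import all_boot all_order all_algebra.
From mathcomp Require Import finmap.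
From mathcomp Require Import all_classical all_reals all_analysis.
From mathcomp Require Import complex.
From mathcomp.analysis.showcase Require summability.

Set Implicit Arguments.
Unset Strict Implicit.
Unset Printing Implicit Defensive.

Import Order.TTheory GRing.Theory Num.Theory.
Import numFieldNormedType.Exports.

Local Open Scope classical_set_scope.
Local Open Scope complex_scope.
Local Open Scope ring_scope.

Definition cexp (R : realType) (z : R[i]) : R[i] :=
  (expR (complex.Re z))%:C * (cos (complex.Im z) +i* sin (complex.Im z)).

(* The real logarithm [ln x] is used; only meaningful for [0 < x]. *)
Definition cpow (R : realType) (x : R) (z : R[i]) : R[i] :=
  cexp (z * (ln x)%:C).

Definition counting_fun (R : realType) (S : choiceType) (H : S -> R) (B : R) :
    nat :=
  #|` fset_set [set x | H x <= B]|%fset.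

Definition zeta_abs_cvg (R : realType) (S : choiceType) (H : S -> R)
    (s : R[i]) : Prop :=
  summable [set: S] (fun x => (Normc.normc (cpow (H x) (- s)))%:E).

(* [summability.sum] is the limit of the net of finite partial sums. *)
Definition zeta (R : realType) (S : choiceType) (H : S -> R) (s : R[i]) :
    R[i] :=
  summability.sum (fun x => cpow (H x) (- s) : R[i]^o).

(* The function [s |-> P(alpha^-s) / Q(alpha^-s)]. At the isolated zeros of   *)
(* the denominator it takes the value 0; [is_pole] and [laurent_at] only look *)
(* at punctured neighbourhoods, so they do not see these values.              *)
Definition ratfun (R : realType) (alpha : R) (P Q : {poly rat}) (s : R[i]) :
    R[i] :=
  let t := cpow alpha (- s) in
  (map_poly ratr P).[t] / (map_poly ratr Q).[t].

Definition holomorphic_at (R : realType) (f : R[i] -> R[i]) (a : R[i]) : Prop :=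
  \forall s \near (a : R[i]^o), derivable (f : R[i]^o -> R[i]^o) s 1.

Definition is_pole (R : realType) (f : R[i] -> R[i]) (a : R[i]) : Prop :=
  exists (k : nat) (g : R[i] -> R[i]),
    [/\ (0 < k)%N, holomorphic_at g a, g a != 0 &
        \forall s \near (a : R[i]^o)^', f s = g s / (s - a) ^+ k].

Definition poles (R : realType) (alpha : R) (f : R[i] -> R[i]) : set R[i] :=
  [set a | [/\ is_pole f a, 0 <= complex.Re a &
               0 <= complex.Im a < 2 * pi / ln alpha]].

Definition laurent_at (R : realType) (alpha : R) (f : R[i] -> R[i]) (a : R[i])
    (N : nat) (c : nat -> R[i]) : Prop :=
  exists2 g : R[i] -> R[i], holomorphic_at g a &
    \forall s \near (a : R[i]^o)^',
      f s = \sum_(1 <= n < N.+1) c n / ((ln alpha)%:C ^+ n * (s - a) ^+ n)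
            + g s.

(* Main.v *)
Require Import Defs.
From HB Require Import structures.
From mathcomp Require Import all_boot all_order all_algebra.
From mathcomp Require Import finmap.
From mathcomp Require Import all_classical all_reals all_analysis.
From mathcomp Require Import complex.
From mathcomp.analysis.showcase Require summability.
From mathcomp Require Import ring lra zify.

(** Put [t = alpha^-s], [F = P/Q] and [L = ln alpha], so [Z(s) = F(t)].

    A Dirichlet series determines its coefficients.  At integers [s = n], the
    relation [Q Z = P] makes a finite sum of powers, taken over the points of
    height at most [B], as small as [O(B^-n)]; this forces the coefficient of
    each frequency to vanish ([power_sum_vanish]).  Hence the numbers of points
    of given height satisfy the linear recurrence attached to [Q]
    ([level_card_recurrence]).  As there are no points of small height, all
    heights are powers of [alpha] ([height_power]), and for some [M] the numbers
    [b_m] of points of height [alpha^(m-M)] have generating function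
    [t^M F(t)] ([actp_level_seq]).  So the counting function at [B] is a
    partial sum of the [b_m].

    For a pole [a], let [e_a(m) = alpha^(a m) sum_n c_n(a) m^(n-1)/(n-1)!] and
    let [G_a(t)] be its generating function, a rational function of [t] whose
    only singularity is [alpha^-a].  The function [sum_m (m^n/n!) e^(-m u)] is
    [u^-(n+1) + O(1)] as [u -> 0+] ([eulerp_bounded]), with no other polar
    term: [-d/du] maps the one for [n] to [n+1] times the one for [n+1], and a
    derivative has no term in [1/u].  Therefore, near [s = a], [G_a] has the same
    polar part [sum_n c_n / (L (s-a))^n] as [Z] ([polar_part_bounded]).

    The strip [0 <= Re a], [0 <= Im a < 2 pi / L] is in bijection with the
    punctured closed unit disc through [a |-> alpha^-a] ([strip_surj],
    [strip_inj]), so [t^M (F - sum_a G_a)] is bounded near each of its points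
    ([remainder_bounded]).  A rational function with this property that is also
    the generating function of a sequence has all its poles outside the closed
    disc, so the sequence is absolutely summable ([dominated_partial_sums]).
    Applied to [b_m - sum_a e_a(m-M)], this bounds the error by a constant.

    Boundedness at [b] is always tested along the path [b e^(-u)], [u -> 0+],
    which is the half-line [s = a + u/L]; on it the holomorphic remainder of
    a Laurent expansion is bounded by continuity.  Complex derivatives are
    computed to recognize a zero of [Q] at [alpha^-a], of higher order than that
    of [P], as a pole of [Z] ([not_pole_bounded]). *)

Set Implicit Arguments.
Unset Strict Implicit.
Unset Printing Implicit Defensive.

Import Order.TTheory GRing.Theory Num.Theory.
Import numFieldNormedType.Exports.

Local Open Scope classical_set_scope.
Local Open Scope complex_scope.
Local Open Scope ring_scope.

(** * Polynomials acting on sequences *)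

Section Action.
Variable K : comNzRingType.
Implicit Types (p q : {poly K}) (x y : nat -> K).

(** The [m]-th coefficient of [p] times the formal series [sum_m x_m t^m].
    Working with this action keeps formal power series out of the way: the
    equation [actp V x = W] says that [W/V] is the generating function of
    [x]. *)
Definition actp p x (m : nat) : K := \sum_(k < m.+1) p`_k * x (m - k)%N.

(** Truncating [x] reduces the action to a product of polynomials, from which
    associativity follows. *)
Lemma actp_poly p x m n : (m < n)%N ->
  actp p x m = (p * \poly_(i < n) x i)`_m.
Proof.
move=> mn; rewrite coefM; apply: eq_bigr => k _; rewrite coef_poly.
by rewrite (leq_ltn_trans (leq_subr _ _) mn).
Qed.

Lemma actp_coef p q : actp p (fun m => q`_m) = (fun m => (p * q)`_m).
Proof. by apply/funext => m; rewrite coefM. Qed.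

Lemma actpM p q x : actp (p * q) x = actp p (actp q x).
Proof.
apply/funext => m; rewrite (actp_poly _ _ (ltnSn m)) -mulrA coefM.
apply: eq_bigr => k _; congr (_ * _).
by rewrite -actp_poly // ltnS leq_subr.
Qed.

Lemma actpC p q x : actp p (actp q x) = actp q (actp p x).
Proof. by rewrite -!actpM mulrC. Qed.

Lemma actpDr p x y : actp p (fun m => x m + y m) = (fun m => actp p x m + actp p y m).
Proof.
by apply/funext => m; rewrite -big_split; apply: eq_bigr => k _; rewrite mulrDr.
Qed.

Lemma actpDl p q x m : actp (p + q) x m = actp p x m + actp q x m.
Proof. by rewrite -big_split; apply: eq_bigr => k _; rewrite coefD mulrDl. Qed.

Lemma actpNl p x m : actp (- p) x m = - actp p x m.
Proof. by rewrite -sumrN; apply: eq_bigr => k _; rewrite coefN mulNr. Qed.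

Lemma actpBl p q x m : actp (p - q) x m = actp p x m - actp q x m.
Proof. by rewrite actpDl actpNl. Qed.

Lemma actpZr p a x : actp p (fun m => a * x m) = (fun m => a * actp p x m).
Proof.
by apply/funext => m; rewrite mulr_sumr; apply: eq_bigr => k _; rewrite mulrCA.
Qed.

Lemma actpCl a x m : actp a%:P x m = a * x m.
Proof.
rewrite /actp big_ord_recl coefC /= subn0 big1 ?addr0 // => i _.
by rewrite coefC /= mul0r.
Qed.

Lemma actpXn M x m : actp 'X^M x m = if (m < M)%N then 0 else x (m - M)%N.
Proof.
by rewrite (actp_poly _ _ (ltnSn m)) mulrC coefMXn coef_poly ltnS leq_subr.
Qed.

Lemma coef_comp_scale p a k : (p \Po (a *: 'X))`_k = p`_k * a ^+ k.
Proof.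
rewrite comp_polyE coef_sum.
under eq_bigr => i _ do rewrite exprZn !coefZ coefXn.
case: (ltnP k (size p)) => [kp|pk].
  rewrite (bigD1 (Ordinal kp)) //= eqxx mulr1 big1 ?addr0 // => i ik.
  rewrite (_ : (_ == _) = false) ?mulr0 //.
  by apply: contraNF ik => /eqP e; rewrite -val_eqE /= e.
rewrite nth_default // mul0r big1 // => i _.
rewrite (_ : (_ == _) = false) ?mulr0 //.
by apply/eqP => e; have := ltn_ord i; rewrite -e ltnNge pk.
Qed.

Lemma actp_scale p a x :
  actp (p \Po (a *: 'X)) (fun m => a ^+ m * x m) = (fun m => a ^+ m * actp p x m).
Proof.
apply/funext => m; rewrite mulr_sumr; apply: eq_bigr => k _.
rewrite coef_comp_scale.
have -> : a ^+ m = a ^+ k * a ^+ (m - k) by rewrite -exprD subnKC // -ltnS.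
ring.
Qed.

(** Multiplication of [x_m] by [m] is the operator [t d/dt] on generating
    functions, which is a derivation. *)
Lemma actp_theta p x m :
  m%:R * actp p x m = actp ('X * p^`()) x m + actp p (fun i => i%:R * x i) m.
Proof.
rewrite mulr_sumr -big_split; apply: eq_bigr => -[k /=]; rewrite ltnS => km _.
have -> : ('X * p^`())`_k = k%:R * p`_k.
  rewrite coefXM coef_deriv; case: k {km} => [|k]; first by rewrite mul0r.
  by rewrite /= mulr_natl.
have -> : m%:R = k%:R + (m - k)%:R :> K by rewrite -natrD subnKC.
ring.
Qed.
End Action.

Section ActionDomain.
Variable K : idomainType.
Implicit Types (p q : {poly K}) (x y : nat -> K).

(** Over a domain formal power series have no zero divisors: look at the
    lowest nonzero coefficient of [p]. *)
Lemma actp_eq0 p x : p != 0 -> (forall m, actp p x m = 0) -> forall m, x m = 0.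
Proof.
move=> p0 px m; elim/ltn_ind: m => m IH.
have /existsP ex : [exists i : 'I_(size p), p`_i != 0].
  apply/existsP; have sp : (0 < size p)%N by rewrite size_poly_gt0.
  have hs : ((size p).-1 < size p)%N by rewrite prednK.
  by exists (Ordinal hs); rewrite /= -lead_coefE lead_coef_eq0.
have ex' : exists i, p`_i != 0 by case: ex => i; exists i.
case: (ex_minnP ex') => k pk kmin.
have := px (m + k)%N; rewrite /actp.
have hk : (k < (m + k).+1)%N by lia.
rewrite (bigD1 (Ordinal hk)) //= big1 ?addr0.
  by rewrite addnK => /eqP; rewrite mulf_eq0 (negbTE pk) => /eqP.
move=> [j /= hj]; rewrite -val_eqE /= => jk.
case: (ltnP j k) => [jk'|kj].
  have /eqP-> : p`_j == 0 by apply/negPn/negP => /kmin; lia.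
  by rewrite mul0r.
by rewrite IH ?mulr0 //; lia.
Qed.

Lemma actp_inj p x y : p != 0 -> actp p x = actp p y -> x = y.
Proof.
move=> p0 e; apply/funext => m; apply/eqP; rewrite -subr_eq0; apply/eqP.
apply: (@actp_eq0 p (fun m => x m - y m)) => // k.
have -> : (fun m => x m - y m) = (fun m => x m + (-1) * y m).
  by apply/funext => i; rewrite mulN1r.
by rewrite actpDr actpZr e mulN1r subrr.
Qed.
End ActionDomain.

(** * The power sequences m^n/n! and their generating functions *)

Section PowerSeq.
Variable K : numFieldType.

(** Numerator of the generating function of [m^n/n!]: applying [t d/dt] to
    [W/(1-t)^n] and dividing by [n] gives the recursion.  Up to the factor
    [n!] and a shift these are the Eulerian polynomials. *)
Fixpoint eulerp (n : nat) : {poly K} :=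
  if n is k.+1 then
    n%:R^-1 *: ('X * ((1 - 'X) * (eulerp k)^`() + n%:R *: eulerp k))
  else 1.

Lemma actp_eulerp n :
  actp ((1 - 'X) ^+ n.+1) (fun m => m%:R ^+ n / n`!%:R : K) =
  (fun m => (eulerp n)`_m).
Proof.
elim: n => [|n IH]; apply/funext => m.
  rewrite expr1 actpDl -[1](@polyC1 K) actpCl actpNl -['X]expr1 actpXn.
  rewrite !expr0 !mul1r !invr1 coefC.
  by case: m => [|m] //=; rewrite ?subr0 ?subrr.
set p : {poly K} := (1 - 'X) ^+ n.+1 in IH *.
set x := (fun m => _ / n`!%:R) in IH.
have -> : (fun m : nat => m%:R ^+ n.+1 / (n.+1)`!%:R : K) =
          (fun m => n.+1%:R^-1 * (m%:R * x m)).
  by apply/funext => i; rewrite /x factS natrM invfM exprS; ring.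
rewrite actpZr /= coefZ; congr (_ * _).
have theta : actp p (fun i => i%:R * x i) =
    (fun m => ('X * (eulerp n)^`())`_m - actp ('X * p^`()) x m).
  apply/funext => i.
  have := actp_theta p x i; rewrite IH => /eqP.
  rewrite addrC -subr_eq => /eqP <-; congr (_ - _).
  by rewrite coefXM coef_deriv; case: i => [|i]; rewrite ?mul0r //= mulr_natl.
rewrite exprS actpM theta.
have -> : (fun m => ('X * (eulerp n)^`())`_m - actp ('X * p^`()) x m) =
 (fun m => ('X * (eulerp n)^`())`_m + (-1) * actp ('X * p^`()) x m).
  by apply/funext => i; rewrite mulN1r.
rewrite actpDr actpZr actp_coef -actpM.
have -> : (1 - 'X) * ('X * p^`()) = - (n.+1%:R *: 'X) * p :> {poly K}.
  rewrite /p deriv_exp derivB derivX -[1](@polyC1 K) derivC /= sub0r -mulr_natl.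
  rewrite [in RHS]exprS -mul_polyC rmorph_nat polyC1; ring.
rewrite actpM IH actp_coef mulN1r -coefN -coefD.
apply: (congr1 (fun q : {poly K} => q`_m)); rewrite -!mul_polyC; ring.
Qed.
End PowerSeq.

Section TruncExp.
Variable K : numFieldType.

(** Truncation of the series of [e^-u]. *)
Definition texp (N : nat) : {poly K} := \poly_(j < N) ((-1) ^+ j / j`!%:R).

Lemma texpS N : texp N.+1 = texp N + ((-1) ^+ N / N`!%:R) *: 'X^N.
Proof.
apply/polyP => i; rewrite coefD coefZ coefXn !coef_poly ltnS.
by case: ltngtP => [||->]; rewrite ?mulr0 ?mulr1 ?addr0 ?add0r.
Qed.

Lemma deriv_texp N : (texp N.+1)^`() = - texp N.
Proof.
apply/polyP => i; rewrite coef_deriv coefN !coef_poly ltnS.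
case: ltnP => _; last by rewrite mul0rn oppr0.
rewrite factS natrM invfM exprS -[LHS]mulr_natr.
have h : i.+1%:R != 0 :> K by rewrite pnatr_eq0.
move: (i`!%:R^-1) i.+1%:R h => a b h; field; exact: h.
Qed.

Lemma inverse_mod_Xn (v : {poly K}) N : v.[0] = 1 ->
  exists r j : {poly K}, v * (1 + 'X * r) + 'X^(N.+1) * j = 1.
Proof.
move=> v0; have /Bezout_eq1_coprimepP[[i j] /= e] : coprimep v 'X^(N.+1).
  rewrite coprimep_expr // -['X]subr0 -[0](@polyC0 K) coprimep_XsubC.
  by rewrite rootE v0 oner_eq0.
have i0 : root (i - 1) 0.
  rewrite rootE !hornerE; have := congr1 (horner^~ 0) e.
  by rewrite /= !hornerE v0 expr0n /= mulr0 addr0 mulr1 => ->; rewrite subrr.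
have [r] := factor_theorem _ _ i0; rewrite subr0 => ir.
have ei : i = 1 + 'X * r by rewrite mulrC -ir; ring.
by exists r, j; rewrite -[RHS]e ei; congr (_ + _); rewrite mulrC.
Qed.

(** With [E = e^-u], [w = 1 - E] and [G_n = W_n(E)/w^(n+1)], the relation
    [G_n = u^-(n+1) + r] is differentiated.  Since [-d/du] is [t d/dt] for
    [t = e^-u], it turns [G_n] into [(n+1) G_(n+1)] and the principal part
    [u^-(n+1)] into [(n+1) u^-(n+2)]: no term in [1/u] appears.  Here [A] and
    [D] stand for [W_n(E)] and [W_n'(E)], the denominators are cleared, and
    [c], [s] carry the truncation error. *)
Lemma eulerp_texp_step n M (ki E w c A D r s : {poly K}) :
  ki * n.+1%:R = 1 ->
  A * 'X^(n.+1) = w ^+ n.+1 * (1 + 'X^(n.+1) * r) + 'X^(M.+1) * s ->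
  A^`() = D * E^`() ->
  E^`() = - E + 'X^n * 'X * 'X^M * c ->
  w^`() = E - 'X^n * 'X * 'X^M * c ->
  exists r' s' : {poly K},
    ki * (E * (w * D + n.+1%:R * A)) * 'X^(n.+2) =
    w ^+ n.+2 * (1 + 'X^(n.+2) * r') + 'X^M * s'.
Proof.
move=> kik EQ A' E' w'; set k : {poly K} := n.+1%:R in kik *.
have dX m : ('X^(m.+1) : {poly K})^`() = m.+1%:R * 'X^m.
  by rewrite derivXn -mulr_natl.
have dw : (w ^+ n.+1)^`() = k * (w ^+ n * w^`()).
  by rewrite deriv_exp /= -[LHS]mulr_natl [w^`() * _]mulrC.
have DEQ := congr1 deriv EQ.
rewrite derivM A' dX derivD derivM dw derivD derivM dX derivM dX E' w' in DEQ.
rewrite -[1 in X in X^`()](@polyC1 K) derivC add0r -/k in DEQ.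
rewrite !exprS in EQ DEQ *.
move: ('X^n) ('X^M) (w ^+ n) EQ DEQ => Xn XM wn EQ DEQ.
exists (- ki * r^`()).
exists (ki * (w * 'X * D * Xn * 'X * c * Xn * 'X + k * w * 'X * s
  + k * 'X * wn * w * Xn * 'X * c * (1 + 'X * Xn * r) - w * 'X * M.+1%:R * s
  - w * 'X * 'X * s^`() + k * E * 'X * 'X * s)).
clear A' E' w' dX dw.
move: (r^`()) (s^`()) (M.+1%:R : {poly K}) k kik EQ DEQ => r' s' m k kik EQ DEQ.
apply/eqP; rewrite -subr_eq0; apply/eqP.
set L1 := (X in X = _) in EQ; set R1 := (X in _ = X) in EQ.
set L2 := (X in X = _) in DEQ; set R2 := (X in _ = X) in DEQ.
transitivity (ki * (w * k + E * 'X * k) * (L1 - R1) - ki * w * 'X * (L2 - R2)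
  + (ki * k - 1) * (w * (w * wn))); last by rewrite kik EQ DEQ; ring.
rewrite /L1 /R1 /L2 /R2; ring.
Qed.

(** The generating function of [m^n/n!] at [t = e^-u] equals
    [u^-(n+1) + r(u)] with [r] regular at [0], as an identity of polynomials
    in [u] up to the order of truncation.  This replaces the computation of a
    residue: it says that [u^-(n+1)] as a polar part contributes exactly
    [m^n/n!] to the coefficients. *)
Lemma eulerp_texp N n : (n <= N)%N -> exists r s : {poly K},
  (eulerp K n \Po texp N.+1) * 'X^(n.+1) =
  (1 - texp N.+1) ^+ n.+1 * (1 + 'X^(n.+1) * r) + 'X^(N - n) * s.
Proof.
set E := texp N.+1; set w := 1 - E; pose c : {poly K} := ((-1) ^+ N / N`!%:R)%:P.
have E' : E^`() = - E + 'X^N * c.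
  by rewrite deriv_texp /E texpS -mul_polyC -/c; ring.
have w' : w^`() = E - 'X^N * c.
  by rewrite /w derivB E' -[1](@polyC1 K) derivC; ring.
elim: n => [|n IH] nN.
  case: N @E @w @c E' w' nN => [|N] E w c E' w' _.
    by exists 0, ('X - w); rewrite /= comp_polyC polyC1; ring.
  have E0 : E.[0] = 1.
    by rewrite horner_coef0 coef_poly /= expr0 mul1r invr1.
  have w0 : root w 0 by rewrite rootE !hornerE E0 subrr.
  have [v] := factor_theorem _ _ w0; rewrite subr0 => wv.
  have v0 : v.[0] = 1.
    have := w'; rewrite wv derivM derivX => /(congr1 (horner^~ 0)).
    by rewrite /= !hornerE E0 expr0n /= => ->; ring.
  have [r [j e]] := inverse_mod_Xn N v0.
  exists r, ('X * j); rewrite /= comp_polyC polyC1 subn0 wv.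
  transitivity ('X * (v * (1 + 'X * r) + 'X^(N.+1) * j)); last by ring.
  by rewrite e; ring.
have [r [s EQ]] := IH (ltnW nN).
have [M NM] : exists M, (N = n + M.+1)%N by exists (N - n).-1; lia.
have -> : (N - n.+1 = M)%N by lia.
have NnM : (N - n = M.+1)%N by lia.
rewrite {}NnM in EQ.
have XN : 'X^N = 'X^n * 'X * 'X^M :> {poly K} by rewrite NM exprD exprS mulrA.
rewrite XN in E' w' *; clear IH XN.
pose k : {poly K} := n.+1%:R; pose ki : {poly K} := (n.+1%:R^-1)%:P.
have kik : ki * k = 1.
  have -> : k = (n.+1%:R)%:P by rewrite rmorph_nat.
  by rewrite /ki -polyCM mulVf ?polyC1 // pnatr_eq0.
pose A := eulerp K n \Po E; pose D := (eulerp K n)^`() \Po E.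
have WS : eulerp K n.+1 \Po E = ki * (E * (w * D + k * A)).
  rewrite /= -!mul_polyC -/ki.
  rewrite !(comp_polyM, comp_polyB, comp_polyD, comp_polyC, comp_polyX) polyC1.
  by rewrite -/A -/D -/w rmorph_nat -/k.
rewrite {}WS.
have A' : A^`() = D * E^`() by rewrite /A deriv_comp.
rewrite -/A in EQ.
exact: (eulerp_texp_step kik EQ A' E' w').
Qed.
End TruncExp.

(** * Bounds for polynomials and Taylor estimates *)

Section PolyBound.
Variable K : numFieldType.

(** Both bounds are proved at once because the Lipschitz bound for [p X + a]
    uses the size of [p]. *)
Lemma poly_lipschitz (p : {poly K}) (A : K) : 0 <= A -> exists2 c : K, 0 <= c &
  forall x y, `|x| <= A -> `|y| <= A ->
    `|p.[x]| <= c /\ `|p.[x] - p.[y]| <= c * `|x - y|.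
Proof.
move=> A0; elim/poly_ind: p => [|p a [c c0 cP]].
  by exists 0 => // x y _ _; rewrite !horner0 subr0 normr0 mul0r.
exists (c * A + c + `|a|) => [|x y xA yA].
  by rewrite !addr_ge0 // mulr_ge0.
have [px pxy] := cP x y xA yA; have [py _] := cP y x yA xA.
rewrite !hornerE; split.
  rewrite (le_trans (ler_normD _ _)) // lerD2r (le_trans _ (_ : c * A <= _)) //.
    by rewrite normrM ler_pM.
  by rewrite lerDl.
have -> : p.[x] * x + a - (p.[y] * y + a) = (p.[x] - p.[y]) * x + p.[y] * (x - y).
  by ring.
rewrite (le_trans (ler_normD _ _)) // !normrM !mulrDl -[leRHS]addrA lerD //.
  by rewrite mulrAC ler_pM.
by rewrite ler_wpDr ?mulr_ge0 // ler_pM.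
Qed.
End PolyBound.

Section RealTaylor.
Variable R : realType.
Implicit Types (f df : R -> R).

Lemma taylor_bound f df (c : R) n :
  (forall x : R, is_derive x (1 : R) f (df x)) -> f 0 = 0 -> 0 <= c ->
  (forall x, `|x| <= 1 -> `|df x| <= c * `|x| ^+ n) ->
  forall x, `|x| <= 1 -> `|f x| <= c * `|x| ^+ n.+1.
Proof.
move=> dfP f0 c0 dfb x x1.
have cf (a b : R) : {within `[a, b], continuous f}.
  by apply: derivable_within_continuous => z _; apply: ex_derive.
have key a : `|a| <= `|x| -> `|f x| = `|df a| * `|x| -> `|f x| <= c * `|x| ^+ n.+1.
  move=> ax ->; rewrite exprSr mulrA ler_wpM2r //.
  by rewrite (le_trans (dfb _ (le_trans ax x1))) // ler_wpM2l // lerXn2r ?nnegrE.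
case: (leP 0 x) => x0.
  have [a /itvP ax e] := MVT_segment x0 (fun z _ => dfP z) (cf 0 x).
  rewrite f0 !subr0 in e.
  by apply: (key a); rewrite ?e ?normrM // !ger0_norm ?ax.
have [a /itvP ax e] := MVT_segment (ltW x0) (fun z _ => dfP z) (cf x 0).
rewrite f0 !sub0r in e.
apply: (key a); last by rewrite -[ `|f x| ]normrN e normrM normrN.
by rewrite !ler0_norm ?ax ?(ltW x0) // lerN2 ax.
Qed.

(** The difference vanishes at [0] and its derivative is, up to sign, the
    difference for the previous truncation. *)
Lemma expRN_texp N (u : R) : `|u| <= 1 ->
  `|expR (- u) - (texp R N).[u]| <= expR 1 * `|u| ^+ N.
Proof.
elim: N u => [|N IH] u u1.
  rewrite /texp poly_def big_ord0 horner0 subr0 expr0 mulr1.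
  rewrite ger0_norm ?expR_ge0 // ler_expR.
  by rewrite (le_trans _ u1) // -normrN ler_norm.
apply: (@taylor_bound (fun u => expR (- u) - (texp R N.+1).[u])
  (fun u => - (expR (- u) - (texp R N).[u]))) => //; first last.
- by move=> x x1; rewrite normrN; exact: IH.
- by rewrite oppr0 expR0 horner_coef0 coef_poly /= expr0 mul1r invr1 subrr.
move=> x.
have -> : - (expR (- x) - (texp R N).[x]) = - expR (- x) - (texp R N.+1)^`().[x].
  by rewrite deriv_texp hornerN opprK opprB addrC.
apply: is_deriveB.
have := @is_derive1_comp _ (@expR R) (fun x => - x) x (expR (- x)) (-1).
by rewrite mulrN1; apply.
Qed.

Lemma expRN_ge (u : R) : 0 < u <= 1 -> u / 2 <= 1 - expR (- u).
Proof.
move=> /andP[u0 u1]; have h := expR_ge1Dx u; have e0 := expR_gt0 u.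
rewrite expRN.
have : (expR u)^-1 <= (1 + u)^-1 by rewrite lef_pV2 ?posrE //; lra.
suff : (1 + u)^-1 <= 1 - u / 2 by lra.
rewrite -[leLHS]mul1r ler_pdivrMr; last by lra.
nra.
Qed.

(** The truncation of order [3n+2] in [eulerp_texp] leaves an error
    [O(u^(2n+2))], the order of vanishing of the denominator
    [(1-e^-u)^(n+1) u^(n+1)]. *)
Lemma eulerp_bounded n : exists2 c : R, 0 <= c & forall u, 0 < u <= 1 ->
  `|(eulerp R n).[expR (- u)] / (1 - expR (- u)) ^+ n.+1 - u ^- n.+1| <= c.
Proof.
(* N - n = 2n+2 is the exponent of the error term in eulerp_texp. *)
pose N := (n + (n.+1 + n.+1))%N.
have nN : (n <= N)%N by rewrite leq_addr.
have [r [s EQ]] := eulerp_texp R nN.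
have NN : (n.+1 + n.+1 <= N.+1)%N by rewrite /N; clear; lia.
have Nn : (N - n = n.+1 + n.+1)%N by rewrite /N addKn.
rewrite {}Nn in EQ.
pose E := texp R N.+1; pose W := eulerp R n.
have e0 : 0 <= expR 1 :> R := expR_ge0 1.
have A0 : 0 <= 1 + expR 1 :> R by rewrite addr_ge0.
have [cr cr0 rb] := poly_lipschitz r ler01.
have [cs cs0 sb] := poly_lipschitz s ler01.
have [cW cW0 Wb] := poly_lipschitz W A0.
have [cp cp0 pb] := poly_lipschitz ((1 - 'X) ^+ n.+1) A0.
pose c1 : R := expR 1 + 1.
have c10 : 0 <= c1 by rewrite addr_ge0.
pose c := cW * expR 1 + cp * expR 1 + c1 ^+ n.+1 * cr + cs.
have cge : 0 <= c by rewrite !addr_ge0 // mulr_ge0 ?exprn_ge0.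
exists (c * 2 ^+ n.+1) => [|u u01]; first by rewrite mulr_ge0 ?exprn_ge0.
have /andP[u0 u1] := u01.
have nu : `|u| = u by rewrite gtr0_norm.
have nu1 : `|u| <= 1 by rewrite nu.
set e := expR (- u).
have Ee : `|e - E.[u]| <= expR 1 * u ^+ N.+1.
  by rewrite -[in leRHS]nu; exact: expRN_texp.
have uN1 : u ^+ N.+1 <= 1 by rewrite exprn_ile1 ?(ltW u0).
have ne : `|e| <= 1 + expR 1.
  by rewrite ger0_norm ?expR_ge0 // ler_wpDr // expR_le1 oppr_le0 ltW.
have nE : `|E.[u]| <= 1 + expR 1.
  rewrite -[E.[u]](subKr e) (le_trans (ler_normB _ _)) // lerD //.
    by rewrite ger0_norm ?expR_ge0 // expR_le1 oppr_le0 ltW.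
  by rewrite (le_trans Ee) // ler_piMr.
have un m k : (k <= m)%N -> u ^+ m <= u ^+ k.
  by move=> km; rewrite ler_wiXn2l ?(ltW u0).
have E1u : `|1 - E.[u]| <= c1 * u.
  have -> : 1 - E.[u] = (e - E.[u]) + (1 - e) by ring.
  rewrite (le_trans (ler_normD _ _)) // mulrDl mul1r lerD //.
    by rewrite (le_trans Ee) // ler_wpM2l // -[leRHS]expr1 un.
  have := expR_ge1Dx (- u); rewrite ger0_norm -/e; first by lra.
  by rewrite subr_ge0 expR_le1 oppr_le0 ltW.
have num : `|W.[e] * u ^+ n.+1 - (1 - e) ^+ n.+1| <= c * u ^+ (n.+1 + n.+1).
  have EQu := congr1 (horner^~ u) EQ.
  rewrite /= !(hornerE, horner_comp, horner_exp) -/E -/W in EQu.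
  have -> : W.[e] * u ^+ n.+1 - (1 - e) ^+ n.+1 =
    (W.[e] - W.[E.[u]]) * u ^+ n.+1
    - (((1 - 'X) ^+ n.+1).[e] - ((1 - 'X) ^+ n.+1).[E.[u]])
    + (1 - E.[u]) ^+ n.+1 * (u ^+ n.+1 * r.[u]) + u ^+ (n.+1 + n.+1) * s.[u].
    have wE x : ((1 - 'X) ^+ n.+1 : {poly R}).[x] = (1 - x) ^+ n.+1.
      by rewrite horner_exp !hornerE.
    by rewrite !wE mulrBl EQu; ring.
  rewrite (le_trans (ler_normD _ _)) // [c * _]mulrDl lerD //; last first.
    have [sb' _] := sb u u nu1 nu1.
    by rewrite normrM mulrC ler_pM // normrX nu.
  rewrite (le_trans (ler_normD _ _)) // [leRHS]mulrDl lerD //; last first.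
    have [rb' _] := rb u u nu1 nu1.
    have h : `|1 - E.[u]| ^+ n.+1 <= (c1 * u) ^+ n.+1.
      by rewrite lerXn2r ?nnegrE // mulr_ge0 // ltW.
    have un0 : 0 <= u ^+ n.+1 by rewrite exprn_ge0 // ltW.
    have -> : c1 ^+ n.+1 * cr * u ^+ (n.+1 + n.+1) =
        (c1 * u) ^+ n.+1 * (u ^+ n.+1 * cr).
      by rewrite exprMn exprD; ring.
    rewrite !normrM !normrX nu ler_pM ?exprn_ge0 ?mulr_ge0 //.
    by rewrite ler_wpM2l.
  rewrite (le_trans (ler_normB _ _)) // [leRHS]mulrDl lerD //; last first.
    have [_ pb'] := pb _ _ ne nE.
    rewrite (le_trans pb') // -mulrA ler_wpM2l // (le_trans Ee) // ler_wpM2l //.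
    exact: un.
  have [_ Wb'] := Wb _ _ ne nE.
  rewrite normrM normrX nu exprD [leRHS]mulrA ler_wpM2r ?(exprn_ge0 _ (ltW u0)) //.
  rewrite (le_trans Wb') // -mulrA ler_wpM2l // (le_trans Ee) // ler_wpM2l //.
  exact: un.
have e1 : u / 2 <= 1 - e := expRN_ge u01.
have e1p : 0 < 1 - e by apply: lt_le_trans e1; rewrite divr_gt0.
have -> : W.[e] / (1 - e) ^+ n.+1 - u ^- n.+1 =
  (W.[e] * u ^+ n.+1 - (1 - e) ^+ n.+1) / ((1 - e) ^+ n.+1 * u ^+ n.+1).
  by field; rewrite !expf_neq0 ?gt_eqF.
rewrite normrM normfV [ `|_ * u ^+ _| ]ger0_norm; last first.
  by rewrite mulr_ge0 ?exprn_ge0 ?ltW.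
rewrite ler_pdivrMr ?mulr_gt0 ?exprn_gt0 // (le_trans num) //.
rewrite -mulrA ler_wpM2l // exprD mulrA ler_wpM2r ?exprn_ge0 ?(ltW u0) //.
rewrite -exprMn lerXn2r ?nnegrE ?mulr_ge0 ?(ltW u0) ?(ltW e1p) //; lra.
Qed.
End RealTaylor.

(** * The real-valued norm of complex numbers *)

Section ComplexNorm.
Variable R : realType.
Implicit Types (z w : R[i]).
Local Notation normc := (@Normc.normc R).

Lemma normcE z : (normc z)%:C = `|z|. Proof. by []. Qed.

Lemma normc_le z (x : R) : (normc z <= x) = (`|z| <= x%:C).
Proof. by rewrite -normcE lecR. Qed.

Lemma normc_ge0 z : 0 <= normc z.
Proof. by rewrite -lecR normcE normr_ge0. Qed.

Lemma normc_gt0 z : (0 < normc z) = (z != 0).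
Proof. by rewrite -ltcR normcE normr_gt0. Qed.

Lemma normcN z : normc (- z) = normc z.
Proof. by apply: complexI; rewrite !normcE normrN. Qed.

Lemma normcD z w : normc (z + w) <= normc z + normc w.
Proof. by rewrite normc_le rmorphD /= !normcE ler_normD. Qed.

Lemma normcB z w : normc (z - w) <= normc z + normc w.
Proof. by rewrite -(normcN w) normcD. Qed.

Lemma normcX z n : normc (z ^+ n) = normc z ^+ n.
Proof. by apply: complexI; rewrite rmorphXn /= !normcE normrX. Qed.

Lemma normc_real (x : R) : normc x%:C = `|x|.
Proof. by rewrite /= expr0n addr0 sqrtr_sqr. Qed.

Lemma normc_sum (I : Type) (s : seq I) (P : pred I) (f : I -> R[i]) :
  normc (\sum_(i <- s | P i) f i) <= \sum_(i <- s | P i) normc (f i).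
Proof.
rewrite normc_le rmorph_sum /= (le_trans (ler_norm_sum _ _ _)) //.
Qed.

Lemma poly_lipschitz_normc (p : {poly R[i]}) (a : R) : 0 <= a ->
  exists2 c : R, 0 <= c & forall x y, normc x <= a -> normc y <= a ->
    normc p.[x] <= c /\ normc (p.[x] - p.[y]) <= c * normc (x - y).
Proof.
move=> a0; have A0 : 0 <= a%:C :> R[i] by rewrite ler0c.
have [c c0 cP] := poly_lipschitz p A0.
have cE : c = (complex.Re c)%:C by rewrite RRe_real // ger0_real.
exists (complex.Re c) => [|x y xa ya]; first by rewrite -ler0c -cE.
have [] := cP x y; rewrite -?normc_le //.
by rewrite cE -normcE -rmorphM !normc_le.
Qed.

End ComplexNorm.

(** * Behaviour along the radial paths b e^(-u) *)

Section Radial.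
Variable R : realType.
Local Notation C := R[i].
Local Notation normc := (@Normc.normc R).
Implicit Types (p V W : {poly C}) (b : C) (f g : R -> C).

(** With [b = alpha^-a] this is [alpha^-s] at [s = a + u / ln alpha], so that
    [u -> 0+] approaches the pole [a] from the right.  The path stays in the
    disc of radius [|b|]. *)
Definition radial b (u : R) : C := b * (expR (- u))%:C.

Lemma expRN_itv (u : R) : 0 < u -> 0 < expR (- u) < 1.
Proof. by move=> u0; rewrite expR_gt0 expR_lt1 oppr_lt0. Qed.

Lemma normc_radial b u : 0 < u -> normc (radial b u) <= normc b.
Proof.
move=> u0; have /andP[h1 h2] := expRN_itv u0.
rewrite Normc.normcM normc_real gtr0_norm // ler_piMr ?normc_ge0 //.
exact: ltW.
Qed.

Lemma radial_dist b u : 0 < u -> normc (radial b u - b) <= normc b * u.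
Proof.
move=> u0; have /andP[h1 h2] := expRN_itv u0.
have -> : radial b u - b = b * (expR (- u) - 1)%:C.
  by rewrite /radial rmorphB rmorph1 mulrBr mulr1.
rewrite Normc.normcM normc_real ler_wpM2l ?normc_ge0 //.
rewrite ltr0_norm ?subr_lt0 //; have := expR_ge1Dx (- u); lra.
Qed.

Lemma radial_neq b u : b != 0 -> 0 < u -> radial b u != b.
Proof.
move=> b0 u0; have /andP[h1 h2] := expRN_itv u0.
rewrite -subr_eq0.
have -> : radial b u - b = b * (expR (- u) - 1)%:C.
  by rewrite /radial rmorphB rmorph1 mulrBr mulr1.
rewrite mulf_eq0 negb_or b0 /= -[0](rmorph0 (real_complex R)).
by rewrite (inj_eq (@complexI R)) subr_eq0 lt_eqF.
Qed.

Lemma horner_radial p b : exists2 c : R, 0 <= c & forall u, 0 < u ->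
  normc p.[radial b u] <= c /\ normc (p.[radial b u] - p.[b]) <= c * u.
Proof.
have [c c0 cP] := poly_lipschitz_normc p (normc_ge0 b).
exists (c + c * normc b) => [|u u0].
  by rewrite addr_ge0 ?mulr_ge0 ?normc_ge0.
have [h1 h2] := cP _ _ (normc_radial b u0) (lexx _); split.
  by rewrite (le_trans h1) // lerDl mulr_ge0 ?normc_ge0.
rewrite (le_trans h2) // mulrDl -mulrA.
rewrite ler_wpDl ?(mulr_ge0 c0 (ltW u0)) // ler_wpM2l //.
exact: radial_dist.
Qed.

Lemma horner_radial_ge p b : p.[b] != 0 -> exists2 c : R, 0 < c &
  \forall u \near 0^'+, c <= normc p.[radial b u].
Proof.
move=> pb; have [c c0 cP] := horner_radial p b.
have d0 : 0 < normc p.[b] by rewrite normc_gt0.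
exists (normc p.[b] / 2); first by rewrite divr_gt0.
have e0 : 0 < normc p.[b] / 2 / (c + 1).
  by rewrite !divr_gt0 // ltr_wpDl.
near=> u.
have u0 : 0 < u by near: u; exact: nbhs_right_gt.
have [_ h] := cP u u0.
have : c * u <= normc p.[b] / 2.
  have : u <= normc p.[b] / 2 / (c + 1) by near: u; exact: nbhs_right_le.
  rewrite ler_pdivlMr ?ltr_wpDl //; nra.
have := normcD (p.[radial b u]) (- (p.[radial b u] - p.[b])).
rewrite normcN opprB addrC subrK; lra.
Unshelve. all: by end_near. Qed.

(** Zeros of a polynomial are isolated. *)
Lemma horner_radial_neq0 p b : p != 0 -> b != 0 ->
  \forall u \near 0^'+, p.[radial b u] != 0.
Proof.
move=> p0 b0; have [m [q]] := multiplicity_XsubC p b.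
rewrite p0 /= => qb pE; have [c c0 cP] := horner_radial_ge qb.
near=> u.
have u0 : 0 < u by near: u; exact: nbhs_right_gt.
rewrite pE hornerM horner_exp hornerXsubC mulf_neq0 //.
  rewrite -normc_gt0 (lt_le_trans c0) //; near: u; exact: cP.
by rewrite expf_neq0 // subr_eq0 radial_neq.
Unshelve. all: by end_near. Qed.

Definition bounded_near0 f :=
  exists K : R, \forall u \near 0^'+, normc (f u) <= K.

Lemma bounded_near0D f g : bounded_near0 f -> bounded_near0 g ->
  bounded_near0 (fun u => f u + g u).
Proof.
move=> [K KP] [M MP]; exists (K + M); near=> u.
rewrite (le_trans (normcD _ _)) // lerD //; near: u; [exact: KP|exact: MP].
Unshelve. all: by end_near. Qed.

Lemma bounded_near0M f g : bounded_near0 f -> bounded_near0 g ->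
  bounded_near0 (fun u => f u * g u).
Proof.
move=> [K KP] [M MP]; exists (K * M); near=> u.
rewrite Normc.normcM ler_pM ?normc_ge0 //; near: u; [exact: KP|exact: MP].
Unshelve. all: by end_near. Qed.

Lemma bounded_near0_cst (a : C) : bounded_near0 (fun=> a).
Proof. by exists (normc a); near=> u. Unshelve. all: by end_near. Qed.

Lemma bounded_near0N f : bounded_near0 f -> bounded_near0 (fun u => - f u).
Proof. by move=> [K KP]; exists K; under eq_near do rewrite normcN. Qed.

Lemma bounded_near0_sum (I : Type) (s : seq I) (F : I -> R -> C) :
  (forall i, bounded_near0 (F i)) -> bounded_near0 (fun u => \sum_(i <- s) F i u).
Proof.
move=> FP; elim: s => [|i s IH].
  by under eq_fun do rewrite big_nil; exact: bounded_near0_cst.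
under eq_fun do rewrite big_cons; exact: bounded_near0D.
Qed.

Lemma bounded_near0_horner p b : bounded_near0 (fun u => p.[radial b u]).
Proof.
have [c c0 cP] := horner_radial p b; exists c; near=> u.
have u0 : 0 < u by near: u; exact: nbhs_right_gt.
by have [] := cP u u0.
Unshelve. all: by end_near. Qed.

Lemma bounded_near0_hornerV p b : p.[b] != 0 ->
  bounded_near0 (fun u => p.[radial b u]^-1).
Proof.
move=> /horner_radial_ge[c c0 cP]; exists c^-1; near=> u.
have h : c <= normc p.[radial b u] by near: u; exact: cP.
by rewrite Normc.normcV lef_pV2 ?posrE // (lt_le_trans c0).
Unshelve. all: by end_near. Qed.

Lemma near_eq_bounded_near0 f g : (\forall u \near 0^'+, f u = g u) ->
  bounded_near0 f -> bounded_near0 g.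
Proof.
move=> fg [K KP]; exists K; near=> u.
have <- : f u = g u by near: u.
by near: u.
Unshelve. all: by end_near. Qed.

End Radial.

(** * Rational functions bounded on the closed disc have summable coefficients *)

Section Summation.
Variable R : realType.
Local Notation C := R[i].
Local Notation normc := (@Normc.normc R).
Implicit Types (V W : {poly C}) (b : C) (x : nat -> C).

Lemma le_near0_eq0 b (K : R) : (\forall u \near 0^'+, normc b <= K * u) -> b = 0.
Proof.
move=> bK; apply: contrapT => /eqP b0; rewrite -normc_gt0 in b0.
have [u [u0 uK]] : exists u, 0 < u /\ normc b <= K * u /\ u < normc b / (`|K| + 1).
  near (0 : R)^'+ => u; exists u; split; first by near: u; exact: nbhs_right_gt.
  split; near: u; first exact: bK.
  by apply: nbhs_right_lt; rewrite divr_gt0 // ltr_wpDl.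
case: uK; rewrite ltr_pdivlMr ?ltr_wpDl // => h1 h2.
have := ler_norm K; nra.
Unshelve. all: by end_near. Qed.

(** [W/V] is bounded near every nonzero point of the closed unit disc, in a
    form that makes sense at the zeros of [V]. *)
Definition dominated_by W V := forall b, b != 0 -> normc b <= 1 ->
  exists K : R, \forall u \near 0^'+,
    normc W.[radial b u] <= K * normc V.[radial b u].

Lemma sum_coef_bounded W : exists K : R, forall m, \sum_(i < m) normc W`_i <= K.
Proof.
exists (\sum_(i < size W) normc W`_i) => m.
rewrite -[leRHS](big_mkord xpredT (fun i => normc W`_i)).
rewrite -(big_mkord xpredT (fun i => normc W`_i)).
case: (leqP m (size W)) => h.
  by rewrite [leRHS](big_cat_nat _ h) //= lerDl sumr_ge0 // => i _; exact: normc_ge0.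
rewrite (big_cat_nat _ (ltnW h)) //= [X in _ + X](_ : _ = 0) ?addr0 //.
rewrite big_nat_cond big1 // => i /andP[/andP[iW _] _]; rewrite nth_default //.
by rewrite Normc.normc0.
Qed.

(** If [|b| > 1], dividing a generating function by [t - b] amounts to
    [b x_m = x_(m-1) - y_m], which is contracting: the sums [S_m] of the
    norms satisfy [|b| S_m <= K + S_m]. *)
Lemma sum_norm_recurrence b x (K : R) : 1 < normc b ->
  (forall m, \sum_(i < m) normc (actp ('X - b%:P) x i) <= K) ->
  forall m, \sum_(i < m) normc (x i) <= K / (normc b - 1).
Proof.
move=> b1 KP m; have bp : 0 < normc b - 1 by rewrite subr_gt0.
rewrite ler_pdivlMr // mulrC.
case: m => [|m]; first by rewrite big_ord0 mulr0; have := KP 0%N; rewrite big_ord0.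
have := KP m.+1; set S := \sum_(i < m.+1) normc (x i).
have xE i : actp ('X - b%:P) x i = (if i is j.+1 then x j else 0) - b * x i.
  rewrite actpBl actpCl -['X]expr1 actpXn.
  by case: i => [|i] //=; rewrite subn1.
have : normc b * S <= \sum_(i < m.+1) normc (actp ('X - b%:P) x i) +
    \sum_(i < m.+1) normc (if (i : nat) is j.+1 then x j else 0).
  rewrite mulr_sumr -big_split ler_sum // => i _.
  rewrite -Normc.normcM xE; set y := (if _ is _.+1 then _ else _).
  rewrite [leRHS]addrC; have := normcB y (y - b * x i); by rewrite subKr.
have -> : \sum_(i < m.+1) normc (if (i : nat) is j.+1 then x j else 0) =
    \sum_(i < m) normc (x i).
  by rewrite big_ord_recl [X in X + _](_ : _ = 0) ?add0r //; exact: Normc.normc0.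
have : \sum_(i < m) normc (x i) <= S.
  by rewrite /S big_ord_recr /= lerDl normc_ge0.
rewrite mulrBl mul1r; lra.
Qed.

(** The zeros of [V] are removed one at a time.  A zero [b] in the closed
    disc must be a zero of [W]: for [b = 0] because the generating function is
    a power series, otherwise because [W/V] is bounded near [b]; so the factor
    cancels.  A zero outside the disc is handled by
    [sum_norm_recurrence]. *)
Lemma dominated_partial_sums V W x : V != 0 -> actp V x = (fun m => W`_m) ->
  dominated_by W V -> exists K : R, forall m, \sum_(i < m) normc (x i) <= K.
Proof.
have [n] := ubnP (size V); elim: n V W x => // n IH V W x.
rewrite ltnS => Vn V0 VW dom.
have [/size_poly1P[v v0 vE]|V1] := boolP (size V == 1%N).
  have [K KP] := sum_coef_bounded W; exists ((normc v)^-1 * K) => m.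
  rewrite (le_trans _ (ler_wpM2l _ (KP m))) ?invr_ge0 ?normc_ge0 //.
  rewrite mulr_sumr ler_sum // => i _.
  rewrite -Normc.normcV -Normc.normcM -(congr1 (@^~ (val i)) VW) vE actpCl.
  by rewrite mulKf.
have [b rb] := closed_rootP V V1; have [V' VE] := factor_theorem V b rb.
have Xb0 : 'X - b%:P != 0 :> {poly C} by rewrite polyXsubC_eq0.
have V'0 : V' != 0 by apply: contraNneq V0 => V'0; rewrite VE V'0 mul0r.
have V'n : (size V' < n)%N.
  by move: Vn; rewrite VE size_Mmonic ?monicXsubC // size_XsubC addn2.
have [b1|b1] := ltP 1 (normc b).
  have VW' : actp V' (actp ('X - b%:P) x) = (fun m => W`_m) by rewrite -actpM -VE.
  have [|K KP] := IH _ _ _ V'n V'0 VW'; last first.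
    by exists (K / (normc b - 1)); exact: sum_norm_recurrence.
  move=> c c0 c1; have [K KP] := dom c c0 c1.
  have [M M0 MP] := horner_radial ('X - b%:P) c.
  exists (`|K| * M); near=> u.
  have u0 : 0 < u by near: u; exact: nbhs_right_gt.
  have [MP' _] := MP u u0.
  have h : normc W.[radial c u] <= K * normc V.[radial c u] by near: u; exact: KP.
  rewrite (le_trans h) // VE hornerM Normc.normcM mulrCA [leRHS]mulrC.
  rewrite ler_wpM2l ?normc_ge0 //.
  by rewrite (le_trans (ler_wpM2r (normc_ge0 _) (ler_norm K))) // ler_wpM2l.
have rW : root W b.
  have [bE|b0] := eqVneq b 0.
    have := congr1 (@^~ 0%N) VW; rewrite /actp big_ord_recl big_ord0 addr0 /=.
    have -> : V`_0 = 0 by apply/eqP; move: rb; rewrite rootE bE horner_coef0.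
    by rewrite mul0r rootE bE horner_coef0 => <-.
  have [K KP] := dom b b0 b1; have [M M0 MP] := horner_radial V b.
  have [M' M0' MP'] := horner_radial W b.
  rewrite rootE; apply/eqP; apply: (@le_near0_eq0 _ (`|K| * M + M')); near=> u.
  have u0 : 0 < u by near: u; exact: nbhs_right_gt.
  have [_ h1] := MP u u0; have [_ h2] := MP' u u0.
  have h : normc W.[radial b u] <= K * normc V.[radial b u] by near: u; exact: KP.
  rewrite (eqP rb) subr0 in h1.
  have := normcB W.[radial b u] (W.[radial b u] - W.[b]); rewrite subKr => h3.
  have : K * normc V.[radial b u] <= `|K| * (M * u).
    by rewrite (le_trans (ler_wpM2r (normc_ge0 _) (ler_norm K))) // ler_wpM2l.
  by rewrite mulrDl -mulrA; lra.
have [W' WE] := factor_theorem W b rW.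
have VW' : actp V' x = (fun m => W'`_m).
  apply: (actp_inj Xb0); rewrite -actpM mulrC -VE VW WE.
  by rewrite actp_coef mulrC.
apply: (IH V' W' x) => //.
move=> c c0 c1; have [K KP] := dom c c0 c1; exists K; near=> u.
have h : normc W.[radial c u] <= K * normc V.[radial c u] by near: u; exact: KP.
have h0 : ('X - b%:P).[radial c u] != 0 by near: u; exact: horner_radial_neq0.
rewrite -normc_gt0 in h0.
by move: h; rewrite VE WE !hornerM !Normc.normcM mulrA ler_pM2r.
Unshelve. all: by end_near. Qed.
End Summation.

(** * Exponential sums in an integer variable *)

Section PowerSums.
Variable R : realType.
Local Notation C := R[i].
Local Notation normc := (@Normc.normc R).

Lemma expr_unbounded (r A : R) : 1 < r ->
  exists n0, forall n, (n0 <= n)%N -> A < r ^+ n.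
Proof.
move=> r1; have bern n : 1 + n%:R * (r - 1) <= r ^+ n.
  elim: n => [|n IH]; first by rewrite mul0r addr0 expr0.
  have r0 : 0 <= r by lra.
  rewrite exprS (le_trans _ (ler_wpM2l r0 IH)) // -natr1 -subr_ge0.
  have -> : r * (1 + n%:R * (r - 1)) - (1 + (n%:R + 1) * (r - 1)) =
    n%:R * (r - 1) ^+ 2 by ring.
  by rewrite mulr_ge0 ?sqr_ge0.
have r10 : 0 < r - 1 by rewrite subr_gt0.
exists (Num.bound (`|A| / (r - 1))) => n hn.
have := archi_boundP (divr_ge0 (normr_ge0 A) (ltW r10)).
rewrite ltr_pdivrMr // => h; rewrite (lt_le_trans _ (bern n)) //.
have : (Num.bound (`|A| / (r - 1)))%:R <= n%:R :> R by rewrite ler_nat.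
have := ler_norm A; nra.
Qed.

(** Applying to the sequence [sum_i w_i nu_i^n] the polynomial in the shift
    operator that kills every frequency but [v] leaves a multiple of [v^n],
    still bounded by a multiple of [b^n]; as [|v| > b] its coefficient
    vanishes. *)
Lemma power_sum_vanish (s : seq (C * C)) (b K : R) (v : C) n0 : 0 < b ->
  b < normc v ->
  (forall n, (n0 <= n)%N -> normc (\sum_(i <- s) i.1 * i.2 ^+ n) <= K * b ^+ n) ->
  \sum_(i <- s | i.2 == v) i.1 = 0.
Proof.
move=> b0 bv sK.
pose p : {poly C} := \prod_(u <- [seq i.2 | i <- s] | u != v) ('X - u%:P).
have pv : p.[v] != 0.
  rewrite horner_prod; elim/big_ind: _ => [|x y x0 y0|u uv].
  - exact: oner_neq0.
  - exact: mulf_neq0.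
  - by rewrite hornerXsubC subr_eq0 eq_sym.
have p0 i : i \in s -> i.2 != v -> p.[i.2] = 0.
  move=> si iv; apply/rootP; rewrite /p -big_filter root_prod_XsubC mem_filter iv.
  exact: map_f.
have pE n : \sum_(k < size p) p`_k * (\sum_(i <- s) i.1 * i.2 ^+ (n + k)) =
    v ^+ n * (p.[v] * \sum_(i <- s | i.2 == v) i.1).
  transitivity (\sum_(i <- s) i.1 * i.2 ^+ n * p.[i.2]).
    under eq_bigr do rewrite mulr_sumr.
    rewrite exchange_big; apply: eq_bigr => i _.
    rewrite horner_coef mulr_sumr; apply: eq_bigr => k _; rewrite exprD; ring.
  rewrite !mulr_sumr [RHS]big_mkcond big_seq [RHS]big_seq.
  apply: eq_bigr => i si; case: eqVneq => [->|iv]; first by ring.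
  by rewrite p0 // mulr0.
set c := \sum_(i <- s | _) _ in pE *.
pose M := \sum_(k < size p) normc p`_k * (K * b ^+ k).
have bound n : (n0 <= n)%N -> normc (p.[v] * c) * (normc v / b) ^+ n <= M.
  move=> hn; rewrite expr_div_n mulrA ler_pdivrMr ?exprn_gt0 // mulrC.
  rewrite -normcX -Normc.normcM -pE (le_trans (normc_sum _ _ _)) //.
  rewrite mulr_suml ler_sum // => k _.
  rewrite Normc.normcM -mulrA ler_wpM2l ?normc_ge0 //.
  rewrite -mulrA -exprD [(k + n)%N]addnC sK //.
  by rewrite (leq_trans hn) // leq_addr.
have v1 : 1 < normc v / b by rewrite ltr_pdivlMr // mul1r.
have [n1 n1P] := expr_unbounded (M / normc (p.[v] * c)) v1.
apply/eqP; apply: contrapT => /negP c0.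
have pc : 0 < normc (p.[v] * c) by rewrite normc_gt0 mulf_neq0.
have := n1P _ (leq_maxl n1 n0); rewrite ltr_pdivrMr // mulrC.
by rewrite ltNge bound // leq_maxr.
Qed.
Lemma big_iota0 (n : nat) (F : nat -> C) :
  \sum_(k <- iota 0 n) F k = \sum_(k < n) F k.
Proof. by rewrite -(big_mkord xpredT) /index_iota subn0. Qed.

Lemma horner_expV_neq0 (a : R) (Q : {poly C}) : 1 < a -> Q != 0 ->
  exists n1, forall n, (n1 <= n)%N -> Q.[(a ^- n)%:C] != 0.
Proof.
move=> a1 Q0; have a0 : 0 < a by rewrite (lt_trans ltr01).
have [m [q]] := multiplicity_XsubC Q 0; rewrite Q0 /= => q0 QE.
have [c c0 cP] := poly_lipschitz_normc q (ler01 : 0 <= 1 :> R).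
have q0p : 0 < normc q.[0] by rewrite normc_gt0.
have [n1 n1P] := expr_unbounded (c / normc q.[0]) a1.
exists n1 => n /n1P; rewrite ltr_pdivrMr // => hn.
have an : 0 < a ^+ n by rewrite exprn_gt0.
have t1 : normc (a ^- n)%:C <= 1.
  rewrite normc_real gtr0_norm ?invr_gt0 //.
  by rewrite invf_le1 // exprn_ege1 // ltW.
have z1 : normc 0 <= 1 by rewrite Normc.normc0.
rewrite QE hornerM horner_exp hornerXsubC subr0 mulf_neq0 //; last first.
  by rewrite expf_neq0 // -normc_gt0 normc_real normr_gt0 invr_neq0 // gt_eqF.
apply/eqP => qt; have [_] := cP _ _ z1 t1.
rewrite qt subr0 sub0r normcN normc_real gtr0_norm ?invr_gt0 //.
by rewrite leNgt ltr_pdivrMr // mulrC hn.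
Qed.
End PowerSums.

(** * From the zeta function to a recurrence on level sets *)

Section Zeta.
Variables (R : realType) (S : choiceType) (H : S -> R).
Hypothesis Hpos : forall x, 0 < H x.
Local Notation C := R[i].
Local Notation normc := (@Normc.normc R).

Lemma ler_sum_fset (f : S -> R) (J J' : {fset S}) : (forall x, 0 <= f x) ->
  (J `<=` J')%fset -> \sum_(x <- J) f x <= \sum_(x <- J') f x.
Proof.
move=> f0 JJ'; pose F x := if x \in J then f x else 0.
have -> : \sum_(x <- J) f x = \sum_(x <- J) F x.
  by apply: eq_big_seq => x xJ; rewrite /F xJ.
rewrite (big_fset_incl _ JJ') => [|x _ xJ]; last by rewrite /F (negbTE xJ).
by apply: ler_sum => x _; rewrite /F; case: ifP.
Qed.

Lemma cexp_real (x : R) : cexp x%:C = (expR x)%:C.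
Proof. by rewrite /cexp /= cos0 sin0 mulr1. Qed.

Lemma cpow_opp_nat (a : R) n : 0 < a -> cpow a (- n%:R) = (a ^- n)%:C.
Proof.
move=> a0; rewrite /cpow -(rmorph_nat (real_complex R)) -rmorphN -rmorphM /=.
by rewrite cexp_real mulNr expRN expRM_natl lnK.
Qed.

(** At an integer all terms are positive reals, so the limit of the net of
    finite sums is their supremum. *)
Lemma zeta_nat n : zeta_abs_cvg H n%:R -> exists D : R,
  [/\ zeta H n%:R = D%:C, forall J : {fset S}, \sum_(x <- J) H x ^- n <= D &
      forall e, 0 < e -> exists J : {fset S}, D - e < \sum_(x <- J) H x ^- n].
Proof.
move=> sm; pose f x := H x ^- n.
have f0 x : 0 <= f x by rewrite invr_ge0 exprn_ge0 // ltW.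
pose E := [set \sum_(x <- J) f x | J in [set: {fset S}]].
have supE : has_sup E.
  split; first by exists (\sum_(x <- fset0) f x), fset0.
  have smf : (\esum_(x in [set: S]) (f x)%:E < +oo)%E.
    move: sm; rewrite /zeta_abs_cvg /summable.
    rewrite (eq_esum (b := fun x => (f x)%:E)) // => x _.
    by rewrite cpow_opp_nat // normc_real abse_EFin normr_id ger0_norm //; exact: f0.
  exists (fine (\esum_(x in [set: S]) (f x)%:E)) => _ [J _ <-].
  have e0 : (0 <= \esum_(x in [set: S]) (f x)%:E)%E.
    by apply: esum_ge0 => x _; rewrite lee_fin.
  rewrite -lee_fin fineK; last by rewrite ge0_fin_numE.
  apply: esum_ge; exists [set` J] => //.
  by rewrite -fsbig_seq // sumEFin.
exists (sup E); split.
- rewrite /zeta /summability.sum.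
  have TF : ProperFilter (@summability.totally S) := summability.totally_filter.
  apply: (@norm_cvg_lim _ C^o _ _ ((sup E)%:C : C^o)).
  apply/cvgrPdist_le => e e0.
  have e0' : 0 < complex.Re e by rewrite -ltcR RRe_real // ?gtr0_real.
  have [_ [J _ <-] hJ] := sup_adherent e0' supE.
  exists J => // J' /= JJ'; rewrite /summability.partial_sum.
  rewrite -(big_seq_fsetE _ J' xpredT (fun x => cpow (H x) (- n%:R))) /=.
  under eq_bigr do rewrite cpow_opp_nat //.
  rewrite -rmorph_sum -rmorphB /= -normcE normc_real.
  have eE : e = (complex.Re e)%:C by rewrite RRe_real // ?gtr0_real.
  rewrite eE lecR ger0_norm; last first.
    by rewrite subr_ge0; apply: (ub_le_sup supE.2); exists J'.
  rewrite lerBlDr -lerBlDl (le_trans (ltW hJ)) //; exact: ler_sum_fset.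
- by move=> J; apply: (ub_le_sup supE.2); exists J.
- move=> e e0; have [_ [J _ <-] h] := sup_adherent e0 supE.
  by exists J.
Qed.
Hypothesis Hfin : forall B : R, 0 < B -> finite_set [set x : S | H x <= B].

Local Notation sublevel B := (fset_set [set x : S | H x <= B]).

Lemma mem_sublevel (B : R) x : 0 < B -> (x \in sublevel B) = (H x <= B).
Proof.
move=> B0; rewrite in_fset_set; last exact: Hfin.
by apply/idP/idP => [/set_mem//|h]; apply/mem_set.
Qed.

(** For [H x > B] one has [H x ^ -n <= B ^ (n0 - n) H x ^ -n0]. *)
Lemma zeta_tail n0 n (c0 D B : R) : (n0 <= n)%N -> 0 < B ->
  (forall J : {fset S}, \sum_(x <- J) H x ^- n0 <= c0) ->
  (forall J : {fset S}, \sum_(x <- J) H x ^- n <= D) ->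
  (forall e, 0 < e -> exists J : {fset S}, D - e < \sum_(x <- J) H x ^- n) ->
  `|D - \sum_(x <- sublevel B) H x ^- n| <= c0 * B ^+ n0 * B ^- n.
Proof.
move=> n0n B0 c0P DP Dapprox.
rewrite ger0_norm ?subr_ge0 // lerBlDl.
apply/ler_addgt0Pr => e e0; have [J hJ] := Dapprox e e0.
rewrite -lerBlDr (le_trans (ltW hJ)) //.
have f0 m x : 0 <= H x ^- m by rewrite invr_ge0 exprn_ge0 // ltW.
rewrite (le_trans (ler_sum_fset (f0 n) (fsubsetUr (sublevel B) J))) //.
set J' := (_ `|` J)%fset.
have IJ' : (sublevel B `<=` J')%fset by exact: fsubsetUl.
pose F x := if x \in sublevel B then H x ^- n else 0.
have -> : \sum_(x <- sublevel B) H x ^- n = \sum_(x <- J') F x.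
  rewrite -(big_fset_incl _ IJ') => [|x _ xI]; last by rewrite /F (negbTE xI).
  by apply: eq_big_seq => x xI; rewrite /F xI.
have le1 : \sum_(x <- J') B ^+ n0 * B ^- n * H x ^- n0 <= c0 * B ^+ n0 * B ^- n.
  rewrite -mulr_sumr mulrC -mulrA ler_wpM2r // mulr_ge0 ?invr_ge0 ?exprn_ge0 // ltW //.
apply: le_trans (lerD (lexx _) le1).
rewrite -big_split /= ler_sum // => x _; rewrite /F mem_sublevel //.
have BB m : 0 <= B ^+ m by rewrite exprn_ge0 // ltW.
case: (leP (H x) B) => [_|BH]; first by rewrite lerDl !mulr_ge0 // invr_ge0.
rewrite add0r -(subnK n0n) !exprD !invfM.
have -> : B ^+ n0 * (B ^- (n - n0) * B ^- n0) * H x ^- n0 = B ^- (n - n0) * H x ^- n0.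
  by field; rewrite !expf_neq0 ?gt_eqF.
rewrite ler_wpM2r // lef_pV2 ?posrE ?exprn_gt0 // lerXn2r ?nnegrE ?ltW //.
Qed.

Definition level_card (l : R) : nat := #|` fset_set [set x : S | H x = l]|%fset.

Lemma sum_sublevel_level (B l : R) : 0 < B -> l <= B ->
  (\sum_(x <- sublevel B) (H x == l))%N = level_card l.
Proof.
move=> B0 lB; have fl : finite_set [set x : S | H x = l].
  by apply: sub_finite_set (Hfin B0) => x /= ->.
rewrite /level_card card_fset_sum1.
have sub : (fset_set [set x : S | H x = l] `<=` sublevel B)%fset.
  by apply/fsubsetP => x; rewrite in_fset_set // inE mem_sublevel // => ->.
have e1 x : x \in fset_set [set x : S | H x = l] -> 1%N = (H x == l).
  by rewrite in_fset_set // inE => /= ->; rewrite eqxx.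
rewrite (eq_big_seq _ e1) /=.
rewrite (big_fset_incl _ sub) // => x _; rewrite in_fset_set //.
by move=> /negP h; apply/eqP; rewrite eqb0; apply/eqP => Hx; apply: h; rewrite inE.
Qed.

(** Cutting the sum at a height [B > l], the relation [Q Z = P] at
    [s = n] becomes a finite sum of powers [nu^n], with
    [nu = 1 / (H x alpha^k)] or [nu = alpha^-j], that is [O(B^-n)].  By
    [power_sum_vanish] the total weight of the frequency [1/l] is zero. *)
Lemma level_card_recurrence (a : R) (P Q : {poly C}) (n0 : nat) :
  1 < a -> Q != 0 ->
  (forall n, (n0 <= n)%N -> zeta_abs_cvg H n%:R) ->
  (forall n, (n0 <= n)%N -> zeta H n%:R = P.[(a ^- n)%:C] / Q.[(a ^- n)%:C]) ->
  forall l, 0 < l ->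
    \sum_(k < size Q) Q`_k * (level_card (l / a ^+ k))%:R =
    \sum_(j < size P) P`_j * (a ^+ j == l)%:R.
Proof.
move=> a1 Q0 cv zE l l0.
have a0 : 0 < a by rewrite (lt_trans ltr01).
have [n1 Qn] := horner_expV_neq0 a1 Q0.
have [D0 [_ D0P _]] := zeta_nat (cv n0 (leqnn n0)).
(* Any cut-off height above l works. *)
pose B := l + 1; have B0 : 0 < B by rewrite addr_gt0.
have lB : l < B by rewrite ltrDl.
have [M M0 MP] := poly_lipschitz_normc Q (ler01 : 0 <= 1 :> R).
pose s : seq (C * C) :=
  [seq (Q`_k, ((H x * a ^+ k)^-1)%:C) | x <- sublevel B, k <- iota 0 (size Q)] ++
  [seq (- P`_j, (a ^- j)%:C) | j <- iota 0 (size P)].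
have B1 : 0 < B^-1 by rewrite invr_gt0.
have Bl : B^-1 < normc (l^-1)%:C.
  by rewrite normc_real gtr0_norm ?invr_gt0 // ltf_pV2 ?posrE.
have sE n : \sum_(i <- s) i.1 * i.2 ^+ n =
    Q.[(a ^- n)%:C] * (\sum_(x <- sublevel B) H x ^- n)%:C - P.[(a ^- n)%:C].
  rewrite big_cat big_allpairs_dep big_map /=; congr (_ + _).
    rewrite rmorph_sum mulr_sumr; apply: eq_bigr => x _.
    rewrite horner_coef mulr_suml big_iota0.
    apply: eq_bigr => k _ /=; rewrite -mulrA -!rmorphXn -rmorphM /=; congr (_ * _%:C).
    by rewrite exprVn exprMn invfM mulrC -!exprVn exprAC.
  rewrite horner_coef -sumrN big_iota0.
  by apply: eq_bigr => j _ /=; rewrite mulNr -!rmorphXn -!exprVn exprAC.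
have := @power_sum_vanish _ s B^-1 (M * (D0 * B ^+ n0)) (l^-1)%:C (maxn n0 n1) B1 Bl.
have -> : \sum_(i <- s | i.2 == (l^-1)%:C) i.1 =
    \sum_(k < size Q) Q`_k * (level_card (l / a ^+ k))%:R -
    \sum_(j < size P) P`_j * (a ^+ j == l)%:R.
  rewrite big_cat big_mkcond big_allpairs_dep big_map /=.
  congr (_ + _).
    rewrite exchange_big /= big_iota0.
    apply: eq_bigr => k _; have ak : 0 < a ^+ k by rewrite exprn_gt0.
    rewrite -(@sum_sublevel_level B) //; last first.
      rewrite ler_pdivrMr // (le_trans (ltW lB)) // ler_peMr ?(ltW B0) //.
      by rewrite exprn_ege1 // ltW.
    rewrite natr_sum mulr_sumr; apply: eq_bigr => x _.
    rewrite (inj_eq (@complexI R)) (inj_eq invr_inj).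
    rewrite [RHS](_ : _ = Q`_k * (H x * a ^+ k == l)%:R); last first.
      congr (_ * (_ : bool)%:R).
      by apply/eqP/eqP => [->|<-]; rewrite ?divfK ?mulfK ?gt_eqF.
    by case: eqP => _; rewrite ?mulr1 ?mulr0.
  rewrite -sumrN big_mkcond big_iota0; apply: eq_bigr => j _.
  rewrite (inj_eq (@complexI R)) (inj_eq invr_inj).
  by case: eqP => _; rewrite ?mulr1 ?mulr0 ?oppr0.
move=> h; apply/eqP; rewrite -subr_eq0; apply/eqP; apply: h => n hn.
have nn0 : (n0 <= n)%N by rewrite (leq_trans _ hn) // leq_maxl.
have nn1 : (n1 <= n)%N by rewrite (leq_trans _ hn) // leq_maxr.
have [D [zD DP Dapprox]] := zeta_nat (cv n nn0).
have PE : P.[(a ^- n)%:C] = Q.[(a ^- n)%:C] * D%:C.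
  by rewrite -zD zE // mulrC divfK // Qn.
rewrite sE PE -mulrBr -rmorphB Normc.normcM normc_real -normrN opprB.
have t1 : normc (a ^- n)%:C <= 1.
  rewrite normc_real ger0_norm ?invr_ge0 ?exprn_ge0 ?(ltW a0) //.
  by rewrite invf_le1 ?exprn_gt0 // exprn_ege1 // ltW.
have [MQ _] := MP _ _ t1 t1.
rewrite -mulrA exprVn ler_pM ?normc_ge0 //.
exact: zeta_tail.
Qed.
End Zeta.

(** * Heights are powers of alpha *)

Section Levels.
Variables (R : realType) (S : choiceType) (H : S -> R).
Hypothesis Hpos : forall x, 0 < H x.
Hypothesis Hfin : forall B : R, 0 < B -> finite_set [set x : S | H x <= B].
Local Notation C := R[i].
Local Notation sublevel B := (fset_set [set x : S | H x <= B]).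
Variables (a : R) (P Q : {poly C}).
Hypothesis a1 : 1 < a.
Hypothesis Q0 : Q != 0.
Hypothesis recQ : forall l, 0 < l ->
  \sum_(k < size Q) Q`_k * (level_card H (l / a ^+ k))%:R =
  \sum_(j < size P) P`_j * (a ^+ j == l)%:R :> C.

Let a0 : 0 < a. Proof. exact: lt_trans a1. Qed.
Let aX m : 0 < a ^+ m. Proof. by rewrite exprn_gt0. Qed.

Lemma level_card_eq0 l : (forall x, H x != l) -> level_card H l = 0%N.
Proof.
move=> Hl; rewrite /level_card (_ : [set x | _] = set0) ?fset_set0 //.
by apply/seteqP; split => x //= /eqP; rewrite (negbTE (Hl x)).
Qed.

Lemma level_card_gt0 x : (0 < level_card H (H x))%N.
Proof.
rewrite cardfs_gt0; apply/fset0Pn; exists x; rewrite in_fset_set ?inE //.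
by apply: sub_finite_set (Hfin (Hpos x)) => y /= ->.
Qed.

Lemma height_lower_bound (A : R) : exists M, forall x, A / a ^+ M < H x.
Proof.
have [h h0 hH] : exists2 h : R, 0 < h & forall x, h <= H x.
  pose h := \big[Num.min/1]_(x <- sublevel 1) H x.
  exists h; first by rewrite /h; elim/big_ind: _ => // x y x0 y0; rewrite lt_min x0.
  move=> x; have [x1|/ltW x1] := leP (H x) 1.
    have xb : x \in sublevel 1 by rewrite mem_sublevel.
    exact: (ge_bigmin_seq 1 x xpredT H xb).
  rewrite (le_trans _ x1) //; exact: bigmin_le_id.
have [M MP] := expr_unbounded (A / h) a1; exists M => x.
have := MP M (leqnn _); rewrite ltr_pdivrMr // => AM.
by rewrite ltr_pdivrMr // (lt_le_trans AM) // mulrC ler_wpM2r // ltW.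
Qed.

(** When no height is [<= l / a^M], the recurrence on [l a^m / a^M] only
    involves terms of nonnegative index, so it is the action of [Q] on a
    sequence. *)
Lemma actp_level l M m : 0 < l -> (forall x, l / a ^+ M < H x) ->
  actp Q (fun m => (level_card H (l * a ^+ m / a ^+ M))%:R) m =
  \sum_(j < size P) P`_j * (a ^+ j == l * a ^+ m / a ^+ M)%:R.
Proof.
move=> l0 lM; have lm0 : 0 < l * a ^+ m / a ^+ M by rewrite divr_gt0 ?mulr_gt0.
rewrite -recQ // /actp; pose n := maxn m.+1 (size Q).
rewrite -(big_mkord xpredT
  (fun k => Q`_k * (level_card H (l * a ^+ (m - k) / a ^+ M))%:R)).
rewrite -(big_mkord xpredT
  (fun k => Q`_k * (level_card H (l * a ^+ m / a ^+ M / a ^+ k))%:R)).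
rewrite (big_nat_widen _ _ n) ?leq_maxl // [RHS](big_nat_widen _ _ n) ?leq_maxr //.
rewrite big_mkcond [RHS]big_mkcond; apply: eq_bigr => k _ /=.
case: ltnP => [km|mk].
  case: ltnP => [kQ|Qk]; last by rewrite nth_default // mul0r.
  congr (_ * (level_card H _)%:R).
  have -> : a ^+ m = a ^+ (m - k) * a ^+ k by rewrite -exprD subnK // -ltnS.
  by field; rewrite !gt_eqF.
rewrite level_card_eq0 ?mulr0 ?if_same // => x; rewrite gt_eqF //.
rewrite (le_lt_trans _ (lM x)) // ler_pdivrMr // mulrAC ler_wpM2l //.
  by rewrite divr_ge0 // ltW.
by rewrite ler_weXn2l ?(ltW a1) // ltnW.
Qed.

(** If [H x] were not in the group generated by [a], the recurrence on its
    coset would be homogeneous and force the level set to be empty. *)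
Lemma height_power x : exists i j, H x = a ^+ i / a ^+ j.
Proof.
apply: contrapT => nx; have [M MP] := height_lower_bound (H x).
pose y m : C := (level_card H (H x * a ^+ m / a ^+ M))%:R.
have y0 : forall m, y m = 0.
  apply: (actp_eq0 Q0) => m; rewrite actp_level // big1 // => j _.
  case: eqP => [e|]; rewrite ?mulr0 //; case: nx; exists (j + M)%N, m.
  by rewrite exprD e; field; rewrite !gt_eqF.
have /eqP := y0 M; rewrite /y mulfK ?(lt0r_neq0 (aX M)) // pnatr_eq0.
by rewrite -leqn0 leqNgt level_card_gt0.
Qed.

Variable M : nat.
Hypothesis MP : forall x, 1 / a ^+ M < H x.

(** Shifting the index by [M] turns the Laurent series of [P/Q] at [t = 0]
    into a power series. *)
Definition level_seq m : C := (level_card H (a ^+ m / a ^+ M))%:R.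

Lemma actp_level_seq : actp Q level_seq = (fun m => ('X^M * P)`_m).
Proof.
apply/funext => m; have := @actp_level 1 M m ltr01 MP.
under [X in actp _ X]eq_fun do rewrite mul1r.
rewrite -/level_seq => ->; rewrite mul1r coefXnM.
have aE j : (a ^+ j == a ^+ m / a ^+ M) = (j + M == m)%N.
  rewrite -(inj_eq (mulIf (lt0r_neq0 (aX M)))) /= divfK ?(lt0r_neq0 (aX M)) // -exprD.
  by rewrite (inj_eq (ieexprIn a0 _)) // gt_eqF.
under eq_bigr do rewrite aE.
case: ltnP => [mM|Mm].
  by rewrite big1 // => j _; rewrite (_ : (_ == _) = false) ?mulr0 //; lia.
case: (ltnP (m - M)%N (size P)) => [mP|Pm].
  rewrite (bigD1 (Ordinal mP)) //= subnK // eqxx mulr1 big1 ?addr0 //.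
  move=> j /eqP jm; rewrite (_ : (_ == _) = false) ?mulr0 //.
  by apply/eqP => e; apply: jm; apply: val_inj; rewrite /= -e addnK.
rewrite nth_default // big1 // => j _; rewrite (_ : (_ == _) = false) ?mulr0 //.
by apply/eqP => e; have := ltn_ord j; rewrite ltnNge; lia.
Qed.

Lemma height_level x : exists m, H x = a ^+ m / a ^+ M.
Proof.
have [i [j e]] := height_power x; exists (i + M - j)%N.
have := MP x; rewrite e ltr_pdivrMr // mulrAC ltr_pdivlMr // mul1r -exprD.
rewrite ltr_eXn2l // => /ltnW ji.
have -> : a ^+ (i + M - j) = a ^+ i * a ^+ M / a ^+ j.
  by rewrite -[in RHS]exprD -[in RHS](subnK ji) exprD mulfK // gt_eqF.
by field; rewrite !gt_eqF.
Qed.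

Lemma counting_fun_level_sum (B : R) l : a ^+ l <= B < a ^+ l.+1 ->
  (counting_fun H B)%:R = \sum_(m < M + l.+1) level_seq m.
Proof.
move=> /andP[lB Bl]; have B0 : 0 < B by rewrite (lt_le_trans _ lB).
rewrite /level_seq -natr_sum; congr (_%:R).
rewrite /counting_fun card_fset_sum1.
transitivity (\sum_(x <- sublevel B) \sum_(m < M + l.+1) (H x == a ^+ m / a ^+ M))%N.
  apply: eq_big_seq => x; rewrite mem_sublevel // => HB.
  have [m Hm] := height_level x.
  have ml : (m < M + l.+1)%N.
    have : a ^+ m < a ^+ (M + l.+1).
      rewrite exprD mulrC -ltr_pdivrMr // -Hm; exact: le_lt_trans Bl.
    by rewrite ltr_eXn2l.
  rewrite (bigD1 (Ordinal ml)) //= Hm eqxx big1 // => i /eqP im.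
  apply/eqP; rewrite eqb0; apply/eqP => /(mulIf _) e; apply: im; apply: val_inj => /=.
  symmetry; apply: (ieexprIn a0); first by rewrite gt_eqF.
  by apply: e; rewrite invr_neq0 // gt_eqF.
rewrite exchange_big; apply: eq_bigr => m _; apply: sum_sublevel_level => //.
rewrite (le_trans _ lB) // ler_pdivrMr // -exprD ler_weXn2l ?(ltW a1) //.
by have := ltn_ord m; lia.
Qed.
End Levels.

(** * The complex exponential *)

Section ComplexExp.
Variable R : realType.
Local Notation C := R[i].
Local Notation normc := (@Normc.normc R).
Implicit Types (z w h : C) (x y : R).

Lemma cexpD z w : cexp (z + w) = cexp z * cexp w.
Proof.
case: z w => [a b] [c d]; rewrite /cexp /= expRD cosD sinD.
rewrite rmorphM mulrACA; congr (_ * _); apply/eqP; rewrite eq_complex /=.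
by apply/andP; split; apply/eqP; ring.
Qed.

Lemma cexp0 : cexp (0 : C) = 1.
Proof. by rewrite /cexp /= expR0 cos0 sin0 mul1r. Qed.

Lemma normc_cexp z : normc (cexp z) = expR (complex.Re z).
Proof.
rewrite /cexp Normc.normcM normc_real ger0_norm ?expR_ge0 //=.
by rewrite cos2Dsin2 sqrtr1 mulr1.
Qed.

Lemma cexp_neq0 z : cexp z != 0.
Proof. by rewrite -normc_gt0 normc_cexp expR_gt0. Qed.

Lemma cexpMn z n : cexp (z * n%:R) = cexp z ^+ n.
Proof.
elim: n => [|n IH]; first by rewrite mulr0 cexp0.
by rewrite -natr1 mulrDr mulr1 cexpD IH exprSr.
Qed.

Lemma normc_Re z : `|complex.Re z| <= normc z.
Proof. by rewrite -lecR normcE normc_ge_Re. Qed.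

Lemma normc_Im z : `|complex.Im z| <= normc z.
Proof.
case: z => a b /=; rewrite -sqrtr_sqr ler_wsqrtr // lerDr sqr_ge0 //.
Qed.

Lemma exp_taylor2 x : `|x| <= 1 ->
  `|expR x - (1 + x + x ^+ 2 / 2)| <= expR 1 * `|x| ^+ 3.
Proof.
move=> x1; have := @expRN_texp R 3 (- x).
rewrite opprK normrN => /(_ x1); rewrite (_ : (texp R 3).[- x] = 1 + x + x ^+ 2 / 2) //.
rewrite horner_poly !big_ord_recr big_ord0 /= (_ : 2`! = 2)%N //.
rewrite (_ : 1`! = 1)%N // (_ : 0`! = 1)%N //.
by field.
Qed.

Lemma sin_bound x : `|x| <= 1 -> `|sin x| <= `|x|.
Proof.
move=> x1; rewrite -[leRHS]mul1r -[ `|x| in leRHS]expr1.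
apply: (@taylor_bound R sin cos) => //; first exact: sin0.
by move=> y y1; rewrite expr0 mulr1 cos_max.
Qed.

Lemma cosB1_bound x : `|x| <= 1 -> `|cos x - 1| <= `|x| ^+ 2.
Proof.
move=> x1; rewrite -[leRHS]mul1r.
apply: (@taylor_bound R (fun x => cos x - 1) (fun x => - sin x)) => //.
- by move=> y; rewrite -[X in is_derive _ _ _ X]subr0; apply: is_deriveB.
- by rewrite cos0 subrr.
- by move=> y y1; rewrite mul1r expr1 normrN sin_bound.
Qed.

Lemma sinB_bound x : `|x| <= 1 -> `|sin x - x| <= `|x| ^+ 3.
Proof.
move=> x1; rewrite -[leRHS]mul1r.
apply: (@taylor_bound R (fun x => sin x - x) (fun x => cos x - 1)) => //.
- by rewrite sin0 subrr.
- by move=> y y1; rewrite mul1r cosB1_bound.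
Qed.

Lemma cosB2_bound x : `|x| <= 1 -> `|cos x - (1 - x ^+ 2 / 2)| <= `|x| ^+ 3.
Proof.
move=> x1; have [le1] : `|cos x - (1 - x ^+ 2 / 2)| <= 1 * `|x| ^+ 4.
  apply: (@taylor_bound R (fun x => cos x - (1 - x ^+ 2 / 2))
    (fun x => - (sin x - x))) => //.
  - move=> y; pose p : {poly R} := 1%:P - 2^-1 *: 'X^2.
    have pE : (fun x => 1 - x ^+ 2 / 2) = horner p.
      by apply/funext => t; rewrite /p hornerD hornerN hornerZ hornerXn hornerC mulrC.
    have -> : - (sin y - y) = - sin y - p^`().[y].
      rewrite /p derivB derivZ derivXn derivC sub0r hornerN hornerZ hornerMn.
      by rewrite hornerXn /= expr1; field.
    rewrite (_ : (fun x => _) = (cos - horner p)); last by rewrite -pE.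
    exact: is_deriveB.
  - by rewrite cos0; field.
  - by move=> y y1; rewrite mul1r normrN sinB_bound.
rewrite (le_trans le1) // mul1r exprS ler_piMl ?exprn_ge0 //.
Qed.

Lemma normc_le_ReIm z : normc z <= `|complex.Re z| + `|complex.Im z|.
Proof.
rewrite {1}(complexE z) (le_trans (normcD _ _)) // lerD ?normc_real //.
rewrite Normc.normcM normc_real (_ : normc 'i%C = 1) ?mul1r //.
by rewrite /= expr0n expr1n add0r sqrtr1.
Qed.

(** Second order is needed for the derivative of [(e^z - 1)/z] at [0].  The
    real and imaginary directions are expanded separately, and
    [A X * A w - A (X + w)] consists of terms of degree at least three. *)
Lemma cexp_taylor2 : exists2 c : R, 0 <= c & forall h, normc h <= 1 ->
  normc (cexp h - (1 + h + h ^+ 2 / 2)) <= c * normc h ^+ 3.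
Proof.
exists (expR 1 + 3 * 2 + 2) => [|h h1]; first by rewrite !addr_ge0 ?expR_ge0.
set t := normc h; have t0 : 0 <= t := normc_ge0 h.
pose a := complex.Re h; pose b := complex.Im h.
pose X : C := a%:C; pose w : C := 0 +i* b.
pose A z : C := 1 + z + z ^+ 2 / 2.
have hE : h = X + w.
  rewrite /X /w /a /b; case: (h) => u v.
  by rewrite /GRing.add /= addr0 add0r.
have at_ : `|a| <= t by exact: normc_Re.
have bt_ : `|b| <= t by exact: normc_Im.
have a1 : `|a| <= 1 := le_trans at_ h1.
have b1 : `|b| <= 1 := le_trans bt_ h1.
have Xt : normc X <= t by rewrite normc_real.
have wt : normc w <= t.
  by rewrite (le_trans (normc_le_ReIm _)) //= normr0 add0r.
pose E2 : C := cos b +i* sin b.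
have e1 : normc ((expR a)%:C - A X) <= expR 1 * t ^+ 3.
  have -> : (expR a)%:C - A X = (expR a - (1 + a + a ^+ 2 / 2))%:C.
    rewrite /A /X rmorphB !rmorphD rmorph1 rmorphM rmorphXn fmorphV.
    by rewrite (rmorph_nat (real_complex R) 2).
  rewrite normc_real (le_trans (exp_taylor2 a1)) // ler_wpM2l ?expR_ge0 //.
  by rewrite lerXn2r ?nnegrE.
have e2 : normc (E2 - A w) <= 2 * t ^+ 3.
  have -> : E2 - A w = (cos b - (1 - b ^+ 2 / 2)) +i* (sin b - b).
    apply/eqP; rewrite eq_complex /E2 /A /w expr2 /=.
    by apply/andP; split; apply/eqP; field.
  rewrite (le_trans (normc_le_ReIm _)) //= mulrDl mul1r lerD //.
    by rewrite (le_trans (cosB2_bound b1)) // lerXn2r ?nnegrE.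
  by rewrite (le_trans (sinB_bound b1)) // lerXn2r ?nnegrE.
have nE2 : normc E2 = 1 by rewrite /= cos2Dsin2 sqrtr1.
have n2 : normc (2^-1 : C) = 2^-1.
  by rewrite -(rmorph_nat (real_complex R)) -fmorphV normc_real ger0_norm.
have nA : normc (A X) <= 3.
  have X2 : normc (X ^+ 2) <= 1 by rewrite normcX exprn_ile1 ?normc_ge0 // (le_trans Xt).
  have X1 : normc X <= 1 by exact: le_trans h1.
  rewrite (le_trans (normcD _ _)) //.
  have := normcD 1 X; rewrite Normc.normcM n2 Normc.normc1; lra.
have -> : cexp h = (expR a)%:C * E2 by [].
have -> : (expR a)%:C * E2 - (1 + h + h ^+ 2 / 2) =
  ((expR a)%:C - A X) * E2 + A X * (E2 - A w) +
  (X * w ^+ 2 / 2 + X ^+ 2 * w / 2 + X ^+ 2 * w ^+ 2 / 2 / 2).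
  by rewrite /A hE; field.
have t3 : t ^+ 4 <= t ^+ 3 by rewrite [leLHS]exprS ler_piMl ?exprn_ge0.
have m1 : normc (X * w ^+ 2) <= t ^+ 3.
  rewrite Normc.normcM normcX (exprS t) ler_pM ?exprn_ge0 ?normc_ge0 //.
  by rewrite lerXn2r ?nnegrE ?normc_ge0.
have m2 : normc (X ^+ 2 * w) <= t ^+ 3.
  rewrite Normc.normcM normcX (exprSr t) ler_pM ?exprn_ge0 ?normc_ge0 //.
  by rewrite lerXn2r ?nnegrE ?normc_ge0.
have m3 : normc (X ^+ 2 * w ^+ 2) <= t ^+ 3.
  rewrite (le_trans _ t3) // Normc.normcM !normcX (exprD t 2 2).
  by rewrite ler_pM ?exprn_ge0 ?normc_ge0 // lerXn2r ?nnegrE ?normc_ge0.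
rewrite (le_trans (normcD _ _)) // [leRHS]mulrDl [X in _ <= X + _]mulrDl lerD //.
  rewrite (le_trans (normcD _ _)) // lerD //.
    by rewrite Normc.normcM nE2 mulr1.
  by rewrite Normc.normcM -mulrA ler_pM ?normc_ge0.
rewrite (le_trans (normcD _ _)) // (le_trans (lerD (normcD _ _) (lexx _))) //.
rewrite !Normc.normcM n2 -!Normc.normcM.
have tt : 0 <= t ^+ 3 by rewrite exprn_ge0.
lra.
Qed.
End ComplexExp.

(** * Complex derivatives *)

Section Holomorphy.
Variable R : realType.
Local Notation C := R[i].
Local Notation normc := (@Normc.normc R).
Implicit Types (f g : C -> C) (z w h l : C).

Lemma nbhs_normcP (P : set C^o) z :
  (\forall w \near (z : C^o), P w) <->
  exists2 d : R, 0 < d & forall w, normc (w - z) < d -> P w.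
Proof.
split.
  move=> /nbhs_ballP[e e0 eP]; have eE : e = (complex.Re e)%:C.
    by rewrite RRe_real // gtr0_real.
  exists (complex.Re e) => [|w wz]; first by rewrite -ltcR -eE.
  apply: eP; rewrite -ball_normE /ball_ /= eE distrC -normcE ltcR.
  exact: wz.
move=> [d d0 dP]; apply/nbhs_ballP; exists d%:C => /=; first by rewrite ltcR.
move=> w; rewrite -ball_normE /ball_ /= distrC -normcE ltcR; exact: dP.
Qed.

Lemma dnbhs_normcP (P : set C^o) z :
  (\forall w \near (z : C^o)^', P w) <->
  exists2 d : R, 0 < d & forall w, w != z -> normc (w - z) < d -> P w.
Proof.
rewrite /dnbhs; split.
  move=> /(@nbhs_normcP (fun w => w != z -> P w)) [d d0 dP].
  by exists d => // w wz wd; exact: dP.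
move=> [d d0 dP]; apply/(@nbhs_normcP (fun w => w != z -> P w)).
by exists d => // w wd wz; exact: dP.
Qed.

Lemma derivable_quadratic f z l (c d : R) : 0 < d ->
  (forall h, normc h < d -> normc (f (z + h) - f z - h * l) <= c * normc h ^+ 2) ->
  derivable (f : C^o -> C^o) z 1.
Proof.
move=> d0 fP; apply/cvg_ex; exists l; apply/cvgrPdist_le => e e0.
have eE : e = (complex.Re e)%:C by rewrite RRe_real // gtr0_real.
have e0' : 0 < complex.Re e by rewrite -ltcR -eE.
have c0 : 0 < `|c| + 1 by rewrite ltr_wpDl.
apply/dnbhs_normcP; exists (Num.min d (complex.Re e / (`|c| + 1))).
  by rewrite lt_min d0 divr_gt0.
move=> h h0; rewrite subr0 lt_min => /andP[hd he].
rewrite eE -normcE lecR.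
have -> : l - h^-1 *: (f (h *: 1 + z) - f z) = - (f (z + h) - f z - h * l) / h.
  rewrite -[h *: 1]/(h * 1) mulr1 [h + z]addrC -[_ *: _]/(h^-1 * _); field; exact: h0.
rewrite Normc.normcM normcN Normc.normcV ler_pdivrMr ?normc_gt0 //.
rewrite (le_trans (fP h hd)) // expr2 mulrA ler_wpM2r ?normc_ge0 //.
move: he; rewrite ltr_pdivlMr // => he.
have := ler_norm c; have := normc_ge0 h; nra.
Qed.

Lemma cexp_linear : exists2 c : R, 0 <= c & forall h, normc h <= 1 ->
  normc (cexp h - (1 + h)) <= c * normc h ^+ 2.
Proof.
have [c c0 cP] := cexp_taylor2 R; exists (c + 1) => [|h h1]; first by rewrite addr_ge0.
have -> : cexp h - (1 + h) = (cexp h - (1 + h + h ^+ 2 / 2)) + h ^+ 2 / 2 by field.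
rewrite (le_trans (normcD _ _)) // mulrDl mul1r lerD //.
  rewrite (le_trans (cP h h1)) // ler_wpM2l // exprS ler_piMl ?exprn_ge0 ?normc_ge0 //.
rewrite Normc.normcM normcX -(rmorph_nat (real_complex R)) -fmorphV normc_real ger0_norm //.
have := exprn_ge0 2 (normc_ge0 h); lra.
Qed.

Lemma derivable_cexp z : derivable (@cexp R : C^o -> C^o) z 1.
Proof.
have [c c0 cP] := cexp_linear.
apply: (@derivable_quadratic _ _ (cexp z) (normc (cexp z) * c) 1) => // h h1.
have -> : cexp (z + h) - cexp z - h * cexp z = cexp z * (cexp h - (1 + h)).
  by rewrite cexpD; ring.
by rewrite Normc.normcM -mulrA ler_wpM2l ?normc_ge0 // cP // ltW.
Qed.

(** The entire function [(e^z - 1)/z], extended by its limit at [0]. *)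
Definition expdiv z : C := if z == 0 then 1 else (cexp z - 1) / z.

Lemma cexp_expdiv z : cexp z - 1 = z * expdiv z.
Proof.
rewrite /expdiv; case: eqVneq => [->|z0]; first by rewrite cexp0 subrr mul0r.
by rewrite mulrC divfK.
Qed.

Lemma derivable_expdiv z : derivable (expdiv : C^o -> C^o) z 1.
Proof.
have [->|z0] := eqVneq z 0.
  have [c c0 cP] := cexp_taylor2 R.
  apply: (@derivable_quadratic _ _ (2^-1) c 1) => // h h1.
  rewrite add0r /expdiv eqxx; case: eqVneq => [->|h0].
    by rewrite subrr mul0r subrr Normc.normc0 expr0n mulr0.
  have -> : (cexp h - 1) / h - 1 - h * 2^-1 = (cexp h - (1 + h + h ^+ 2 / 2)) / h.
    by field; exact: h0.
  rewrite Normc.normcM Normc.normcV ler_pdivrMr ?normc_gt0 // -[leRHS]mulrA.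
  rewrite -(exprSr (normc h) 2).
  by rewrite cP // ltW.
have near0 : \forall w \near (z : C^o), w != 0.
  apply/nbhs_normcP; exists (normc z); first by rewrite normc_gt0.
  by move=> w; apply: contraTneq => ->; rewrite sub0r normcN ltxx.
apply: (@near_eq_derivable _ C^o C^o (fun w : C^o => (cexp w - 1) * w^-1)) => //.
  by near=> w; rewrite /expdiv (negbTE (_ : w != 0)) //; near: w.
pose e1 : C^o -> C^o := (@cexp R : C^o -> C^o) - cst (1 : C^o).
have de1 : derivable e1 z 1.
  by apply: derivableB; [exact: derivable_cexp|exact: derivable_cst].
have did : derivable (id : C^o -> C^o) z 1 by exact: derivable_id.
have dV : derivable (fun w : C^o => w^-1) z 1 by exact: (derivableV z0 did).
exact: (derivableM de1 dV).
Unshelve. all: by end_near. Qed.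

Lemma derivable_continuous f z : derivable (f : C^o -> C^o) z 1 ->
  {for z, continuous (f : C^o -> C^o)}.
Proof. by move=> /derivable1_diffP/differentiable_continuous. Qed.

Lemma continuous_near_neq0 f z : {for z, continuous (f : C^o -> C^o)} ->
  f z != 0 -> \forall w \near (z : C^o), f w != 0.
Proof.
move=> cf fz; have : \forall y \near (f z : C^o), y != 0.
  apply/nbhs_normcP; exists (normc (f z)); first by rewrite normc_gt0.
  by move=> w; apply: contraTneq => ->; rewrite sub0r normcN ltxx.
exact: cf.
Qed.

Lemma derivable_poly (p : {poly C}) f z : derivable (f : C^o -> C^o) z 1 ->
  derivable ((fun s => p.[f s]) : C^o -> C^o) z 1.
Proof.
move=> df; elim/poly_ind: p => [|p a IH].
  by under eq_fun do rewrite horner0; exact: derivable_cst.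
under eq_fun do rewrite hornerMXaddC.
have dM := derivableM IH df.
have dC : derivable (cst (a : C^o) : C^o -> C^o) z 1 by exact: derivable_cst.
exact: (derivableD dM dC).
Qed.

End Holomorphy.

(** * Poles of P(alpha^-s)/Q(alpha^-s) *)

Section Poles.
Variable R : realType.
Local Notation C := R[i].
Local Notation normc := (@Normc.normc R).
Variable alpha : R.
Hypothesis alpha_gt1 : 1 < alpha.
Variables (P Q : {poly C}).
Implicit Types (a s : C) (u : R).
Let L := ln alpha.
Let f s := P.[cpow alpha (- s)] / Q.[cpow alpha (- s)].
Let base a := cpow alpha (- a).

Lemma ln_alpha_gt0 : 0 < L. Proof. exact: ln_gt0. Qed.
Let L0 := ln_alpha_gt0.
Let LC0 : L%:C != 0 :> C.
Proof. by rewrite -normc_gt0 normc_real normr_gt0 gt_eqF. Qed.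

Lemma cpow_opp_shift a s : cpow alpha (- s) = base a * cexp (- L%:C * (s - a)).
Proof. by rewrite /base /cpow -cexpD -/L; congr cexp; ring. Qed.

Lemma cpow_radial a u : cpow alpha (- (a + (u / L)%:C)) = radial (base a) u.
Proof.
rewrite (cpow_opp_shift a) addrAC subrr add0r /radial; congr (_ * _).
have -> : - L%:C * (u / L)%:C = (- u)%:C :> C.
  by rewrite -rmorphN -rmorphM /= mulNr mulrCA divff ?mulr1 // gt_eqF.
exact: cexp_real.
Qed.

Lemma base_neq0 a : base a != 0. Proof. exact: cexp_neq0. Qed.

Lemma near_radial a (A : set C^o) : (\forall s \near (a : C^o)^', A s) ->
  \forall u \near 0^'+, A (a + (u / L)%:C).
Proof.
move=> /dnbhs_normcP[d d0 dP]; near=> u.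
have u0 : 0 < u by near: u; exact: nbhs_right_gt.
have uL : 0 < u / L by rewrite divr_gt0.
apply: dP.
  by rewrite -subr_eq0 addrAC subrr add0r -normc_gt0 normc_real normr_gt0 gt_eqF.
rewrite addrAC subrr add0r normc_real gtr0_norm // ltr_pdivrMr //.
near: u; apply: nbhs_right_lt; exact: mulr_gt0.
Unshelve. all: by end_near. Qed.

Lemma continuous_radial_dist a (g : C -> C) (e : R) : holomorphic_at g a -> 0 < e ->
  \forall u \near 0^'+, normc (g (a + (u / L)%:C) - g a) < e.
Proof.
move=> /nbhs_singleton/derivable_continuous cg e0.
apply: (@near_radial a (fun s => normc (g s - g a) < e)).
apply: (@cvg_within _ (nbhs (a : C^o))).
have : \forall y \near (g a : C^o), normc (y - g a) < e by apply/nbhs_normcP; exists e.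
exact: cg.
Qed.

Lemma bounded_near0_holomorphic a (g : C -> C) : holomorphic_at g a ->
  bounded_near0 (fun u => g (a + (u / L)%:C)).
Proof.
move=> hg; exists (1 + normc (g a)); near=> u.
have h : normc (g (a + (u / L)%:C) - g a) < 1.
  by near: u; exact: continuous_radial_dist.
by rewrite -[g (_ + _)](subrK (g a)) (le_trans (normcD _ _)) // lerD2r ltW.
Unshelve. all: by end_near. Qed.

(** If [Q] does not vanish at [alpha^-a] then [f] is bounded near [a], so
    [g s = f s (s - a)^k] tends to [0] and [g a = 0]. *)
Lemma pole_root a : is_pole f a -> root Q (base a).
Proof.
move=> [k [g [k0 hg ga fg]]]; apply: contraT => Qa.
have g0 : 0 < normc (g a) by rewrite normc_gt0.
have [K KP] : bounded_near0 (fun u => P.[radial (base a) u] / Q.[radial (base a) u]).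
  by apply: bounded_near0M; [exact: bounded_near0_horner|exact: bounded_near0_hornerV].
case/negP: ga; apply/eqP; apply: (@le_near0_eq0 _ _ (2 * `|K| / L)); near=> u.
have u0 : 0 < u by near: u; exact: nbhs_right_gt.
have uL : 0 < u / L by rewrite divr_gt0.
have u1 : u / L <= 1.
  rewrite ler_pdivrMr // mul1r; near: u; exact: nbhs_right_le.
have h1 : f (a + (u / L)%:C) = g (a + (u / L)%:C) / ((u / L)%:C ^+ k).
  have -> : (u / L)%:C ^+ k = (a + (u / L)%:C - a) ^+ k by rewrite addrAC subrr add0r.
  by near: u; exact: (near_radial fg).
have h2 : normc (P.[radial (base a) u] / Q.[radial (base a) u]) <= K by near: u.
have h3 : normc (g (a + (u / L)%:C) - g a) < normc (g a) / 2.
  by near: u; apply: continuous_radial_dist; rewrite ?divr_gt0.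
have ge2 : normc (g a) <= 2 * normc (g (a + (u / L)%:C)).
  have := normcB (g (a + (u / L)%:C)) (g (a + (u / L)%:C) - g a); rewrite subKr; lra.
rewrite (le_trans ge2) // -!mulrA ler_wpM2l //.
have gE : g (a + (u / L)%:C) = f (a + (u / L)%:C) * (u / L)%:C ^+ k.
  by rewrite h1 divfK // expf_neq0 // -normc_gt0 normc_real normr_gt0 gt_eqF.
rewrite gE /f cpow_radial Normc.normcM normcX normc_real ger0_norm ?(ltW uL) //.
rewrite ler_pM ?normc_ge0 ?exprn_ge0 ?(ltW uL) //.
  by rewrite (le_trans h2) // ler_norm.
rewrite [leRHS]mulrC; case: (k) k0 => // j _; rewrite exprS ler_piMr ?(ltW uL) //.
by rewrite exprn_ile1 // ltW.
Unshelve. all: by end_near. Qed.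

Lemma derivable_comp_affine (F : C -> C) (k a z : C) :
  (forall w, derivable (F : C^o -> C^o) w 1) ->
  derivable ((fun s => F (k * (s - a))) : C^o -> C^o) z 1.
Proof.
move=> dF; apply/derivable1_diffP.
apply: (@differentiable_comp _ C^o C^o C^o (fun s : C^o => k * (s - a) : C^o)
  (F : C^o -> C^o)).
  apply/derivable1_diffP.
  have d1 : derivable ((id : C^o -> C^o) - cst (a : C^o)) z 1.
    by apply: derivableB; [exact: derivable_id|exact: derivable_cst].
  exact: (derivableM (derivable_cst (k : C^o) (z : C^o) 1) d1).
exact/derivable1_diffP.
Qed.

(** Write [b = alpha^-a] and let [i], [j] be the orders of vanishing of [P]
    and [Q] at [b].  If [j <= i] the quotient is bounded.  Otherwise [a] is a
    pole of order [j - i]: one has [alpha^-s - b = (s - a) phi s] with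
    [phi s = - ln alpha * b * expdiv (- ln alpha * (s - a))], holomorphic and
    nonzero at [a]. *)
Lemma not_pole_bounded a : Q != 0 -> ~ is_pole f a ->
  bounded_near0 (fun u => P.[radial (base a) u] / Q.[radial (base a) u]).
Proof.
move=> Q0 np; have [->|P0] := eqVneq P 0.
  by under eq_fun do rewrite horner0 mul0r; exact: bounded_near0_cst.
set b := base a; have b0 : b != 0 := base_neq0 a.
have [i [P1]] := multiplicity_XsubC P b; rewrite P0 /= => P1b PE.
have [j [Q1]] := multiplicity_XsubC Q b; rewrite Q0 /= => Q1b QE.
have [ji|ij] := leqP j i.
  have bF : bounded_near0 (fun u =>
      (('X - b%:P) ^+ (i - j) * P1).[radial b u] * Q1.[radial b u]^-1).
    by apply: bounded_near0M; [exact: bounded_near0_horner|exact: bounded_near0_hornerV].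
  apply: near_eq_bounded_near0 bF; near=> u.
  have u0 : 0 < u by near: u; exact: nbhs_right_gt.
  have tb : radial b u - b != 0 by rewrite subr_eq0 radial_neq.
  rewrite PE QE !hornerM !horner_exp hornerXsubC invfM -(subnK ji) exprD addnK.
  move: (Q1.[_]^-1) => q; by field; rewrite expf_neq0.
case: np; pose k := (j - i)%N.
pose phi s : C := - L%:C * b * expdiv (- L%:C * (s - a)).
pose t s : C := b * cexp (- L%:C * (s - a)).
pose g s : C := P1.[t s] * Q1.[t s]^-1 * (phi s ^+ k)^-1.
have ta : t a = b by rewrite /t subrr mulr0 cexp0 mulr1.
have phia : phi a != 0.
  by rewrite /phi subrr mulr0 /expdiv eqxx mulr1 mulf_neq0 // oppr_eq0.
have dt z : derivable (t : C^o -> C^o) z 1.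
  have dE : derivable ((fun s => cexp (- L%:C * (s - a))) : C^o -> C^o) z 1.
    by apply: derivable_comp_affine => w; exact: derivable_cexp.
  exact: (derivableM (derivable_cst (b : C^o) (z : C^o) 1) dE).
have dphi z : derivable (phi : C^o -> C^o) z 1.
  have dE : derivable ((fun s => expdiv (- L%:C * (s - a))) : C^o -> C^o) z 1.
    by apply: derivable_comp_affine => w; exact: derivable_expdiv.
  exact: (derivableM (derivable_cst (- L%:C * b : C^o) (z : C^o) 1) dE).
have tE s : t s - b = (s - a) * phi s.
  rewrite /t /phi -{2}[b]mulr1 -mulrBr cexp_expdiv; ring.
have nphi : \forall s \near (a : C^o), phi s != 0.
  exact: (continuous_near_neq0 (derivable_continuous (dphi a)) phia).
have nQ : \forall s \near (a : C^o), Q1.[t s] != 0.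
  apply: (@continuous_near_neq0 _ (fun s => Q1.[t s])); last by rewrite ta.
  exact: (derivable_continuous (@derivable_poly _ Q1 _ _ (dt a))).
exists k, g; split; first by rewrite subn_gt0.
- rewrite /holomorphic_at; near=> s.
  have ps : phi s != 0 by near: s.
  have qs : Q1.[t s] != 0 by near: s.
  have d1 := @derivable_poly _ P1 _ _ (dt s).
  have d2 := derivableV qs (@derivable_poly _ Q1 _ _ (dt s)).
  have dk : derivable ((fun s => phi s ^+ k) : C^o -> C^o) s 1.
    have -> : (fun s => phi s ^+ k) = (fun s => ('X^k).[phi s]).
      by apply/funext => z; rewrite hornerXn.
    exact: (@derivable_poly _ 'X^k _ _ (dphi s)).
  have psk : phi s ^+ k != 0 by rewrite expf_neq0.
  have d3 := derivableV psk dk.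
  exact: (derivableM (derivableM d1 d2) d3).
- by rewrite /g ta !mulf_neq0 ?invr_neq0 ?expf_neq0.
- have nphi' : \forall s \near (a : C^o)^', phi s != 0.
    exact: (@cvg_within _ (nbhs (a : C^o))).
  have nQ' : \forall s \near (a : C^o)^', Q1.[t s] != 0.
    exact: (@cvg_within _ (nbhs (a : C^o))).
  near=> s; have ps : phi s != 0 by near: s.
  have qs : Q1.[t s] != 0 by near: s.
  have sa : s - a != 0.
    rewrite subr_eq0; near: s; apply/dnbhs_normcP; by exists 1.
  rewrite /f (cpow_opp_shift a) -/b -/(t s) PE QE !hornerM !horner_exp hornerXsubC tE.
  rewrite /g; move: (P1.[t s]) (Q1.[t s]) (phi s) (s - a) ps qs sa => p q r d r0 q0 d0.
  rewrite -[in (d * r) ^+ j](subnK (ltnW ij)) -/k exprD !exprMn.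
  by field; rewrite !expf_neq0 ?q0.
Unshelve. all: by end_near. Qed.

(** At [s = a + u / ln alpha] the normalized Laurent terms
    [c_n / ((ln alpha)^n (s - a)^n)] are [c_n / u^n]. *)
Lemma laurent_bounded a N (c : nat -> C) : laurent_at alpha f a N c ->
  bounded_near0 (fun u => P.[radial (base a) u] / Q.[radial (base a) u]
    - \sum_(1 <= n < N.+1) c n * (u ^- n)%:C).
Proof.
move=> [g hg fE]; apply: near_eq_bounded_near0 (bounded_near0_holomorphic hg).
near=> u.
have u0 : 0 < u by near: u; exact: nbhs_right_gt.
have : f (a + (u / L)%:C) =
    \sum_(1 <= n < N.+1) c n / (L%:C ^+ n * (a + (u / L)%:C - a) ^+ n)
    + g (a + (u / L)%:C) by near: u; exact: (near_radial fE).
rewrite {1}/f cpow_radial => ->; rewrite [RHS]addrAC.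
rewrite [X in _ = X + _](_ : _ = 0) ?add0r //; apply/eqP; rewrite subr_eq0; apply/eqP.
apply: eq_bigr => n _; congr (_ * _); rewrite addrAC subrr add0r.
rewrite -exprMn -rmorphM /= mulrCA divff ?gt_eqF // mulr1.
by rewrite -rmorphXn -fmorphV.
Unshelve. all: by end_near. Qed.
End Poles.

(** * The fundamental strip of alpha^-s *)

Section Strip.
Variable R : realType.
Local Notation C := R[i].
Local Notation normc := (@Normc.normc R).
Implicit Types (x y t : R) (a b : C).

Lemma unit_circle_arg x y : x ^+ 2 + y ^+ 2 = 1 ->
  exists t, [/\ 0 <= t < 2 * pi, x = cos t & y = sin t].
Proof.
move=> xy; have pi0 := pi_gt0 R.
have x1 : -1 <= x <= 1.
  rewrite -ler_norml -(expr_le1 (n := 2)) // real_normK ?num_real //.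
  by rewrite -xy lerDl sqr_ge0.
have xI : x \in `[(-1), 1] by rewrite in_itv.
have y2 : 1 - x ^+ 2 = y ^+ 2 by rewrite -xy; ring.
have sE : sin (acos x) = `|y| by rewrite sin_acos // y2 sqrtr_sqr.
have /andP[a0 ap] : 0 <= acos x <= pi by rewrite acos_ge0 ?acos_lepi.
have [y0|y0] := leP 0 y.
  exists (acos x); split; first by apply/andP; split => //; lra.
    by rewrite acosK.
  by rewrite sE ger0_norm.
have an0 : acos x != 0.
  apply: contraTneq y0 => e; move: sE.
  by rewrite e sin0 => /esym/normr0_eq0 ->; rewrite ltxx.
exists (pi *+ 2 - acos x); split.
- have : 0 < acos x by rewrite lt_neqAle eq_sym an0.
  by rewrite -mulr_natl; move=> ?; apply/andP; split; lra.
- by rewrite addrC cosD2pi cosN acosK.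
- by rewrite addrC sinD2pi sinN sE ltr0_norm // opprK.
Qed.

(** By the duplication formula [sin (t/2)] vanishes, with [t/2] in
    [[0, pi[]. *)
Lemma cos_eq1 t : 0 <= t < 2 * pi -> cos t = 1 -> t = 0.
Proof.
move=> /andP[t0 t2] ct; apply/eqP; rewrite eq_le t0 andbT leNgt; apply/negP => tp.
have h : 0 < t / 2 < pi by apply/andP; split; lra.
have s0 := sin_gt0_pi h.
have : cos (t / 2 + t / 2) = 1 by rewrite -splitr.
rewrite cosD -!expr2 => e; have := cos2Dsin2 (t / 2); nra.
Qed.

Lemma cos_sin_inj t1 t2 : 0 <= t1 < 2 * pi -> 0 <= t2 < 2 * pi ->
  cos t1 = cos t2 -> sin t1 = sin t2 -> t1 = t2.
Proof.
wlog t12 : t1 t2 / t2 <= t1 => [th h1 h2 c s|].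
  have [h|/ltW h] := leP t2 t1; first exact: th.
  by apply/esym; apply: th.
move=> /andP[t10 t1p] /andP[t20 t2p] c s; apply/eqP; rewrite -subr_eq0; apply/eqP.
apply: cos_eq1; first by apply/andP; split; lra.
by rewrite cosB c s -!expr2 cos2Dsin2.
Qed.

Variable alpha : R.
Hypothesis alpha_gt1 : 1 < alpha.
Let L := ln alpha.
Let L0 : 0 < L. Proof. exact: ln_alpha_gt0. Qed.

Definition in_strip a := 0 <= complex.Re a /\ 0 <= complex.Im a < 2 * pi / L.

Lemma cpow_oppE a : cpow alpha (- a) =
  (expR (- (L * complex.Re a)))%:C *
    (cos (L * complex.Im a) -i* sin (L * complex.Im a)).
Proof.
case: a => x y; rewrite /cpow /cexp /= -/L !mulr0 subr0 add0r !mulNr.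
by rewrite cosN sinN ![_ * L]mulrC.
Qed.

Lemma strip_surj b : b != 0 -> normc b <= 1 ->
  exists2 a, in_strip a & cpow alpha (- a) = b.
Proof.
move=> b0 b1; have r0 : 0 < normc b by rewrite normc_gt0.
set r := normc b in b1 r0; pose x := complex.Re b / r; pose y := - (complex.Im b / r).
have r2 : r ^+ 2 = complex.Re b ^+ 2 + complex.Im b ^+ 2.
  rewrite /r; case: (b) => u v /=; rewrite sqr_sqrtr // addr_ge0 ?sqr_ge0 //.
have [|t [/andP[t0 tp] xt yt]] := @unit_circle_arg x y.
  by rewrite /x /y sqrrN !expr_div_n -mulrDl -r2 divff // expf_neq0 // gt_eqF.
exists ((- ln r / L) +i* (t / L)).
  split => /=; first by rewrite divr_ge0 ?(ltW L0) // oppr_ge0 ln_le0.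
  by rewrite divr_ge0 ?(ltW L0) //= ltr_pM2r ?invr_gt0.
rewrite cpow_oppE /= ![L * (_ / L)]mulrC !divfK ?gt_eqF // opprK lnK //.
rewrite -xt -yt /x /y opprK; apply/eqP; rewrite eq_complex /= !mul0r subr0 addr0.
by rewrite ![r * _]mulrC !divfK ?(lt0r_neq0 r0) // !eqxx.
Qed.

Lemma strip_inj a1 a2 : in_strip a1 -> in_strip a2 ->
  cpow alpha (- a1) = cpow alpha (- a2) -> a1 = a2.
Proof.
move=> [x1 y1] [x2 y2] e; have := congr1 normc e.
rewrite /cpow !normc_cexp => /expR_inj.
have ReE a : complex.Re (- a * L%:C) = - (L * complex.Re a).
  by case: a => u v /=; rewrite mulr0 subr0 mulNr mulrC.
rewrite !ReE => /oppr_inj/(mulfI (lt0r_neq0 L0)) re.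
have nz : (expR (- (L * complex.Re a2)))%:C != 0 :> C.
  by rewrite -normc_gt0 normc_real normr_gt0 gt_eqF ?expR_gt0.
move: e; rewrite !cpow_oppE re => /(mulfI nz)[c s].
have strip a : 0 <= complex.Im a < 2 * pi / L -> 0 <= L * complex.Im a < 2 * pi.
  by move=> /andP[h1]; rewrite ltr_pdivlMr // mulrC => h2; rewrite mulr_ge0 ?(ltW L0).
have := cos_sin_inj (strip _ y1) (strip _ y2) c (oppr_inj s).
move=> /(mulfI (lt0r_neq0 L0)) im.
by case: a1 a2 re im {x1 y1 x2 y2 nz c s} => [u v] [u' v'] /= -> ->.
Qed.
End Strip.

(** * Sequences with a rational generating function *)

Section Generating.
Variable R : realType.
Local Notation C := R[i].
Local Notation normc := (@Normc.normc R).
Implicit Types (x y : nat -> C) (F G : C -> C) (b g : C) (c : nat -> C).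

(** [F] is the generating function of [x] as a rational function.  The
    values of [F] at the zeros of the denominator are left free, as they are
    junk values of a division. *)
Definition generates x F := exists V W : {poly C},
  [/\ V != 0, actp V x = (fun m => W`_m) &
      forall t, V.[t] != 0 -> F t = W.[t] / V.[t]].

Lemma generatesD x y F G : generates x F -> generates y G ->
  generates (fun m => x m + y m) (fun t => F t + G t).
Proof.
move=> [V [W [V0 VW FE]]] [V' [W' [V0' VW' GE]]].
exists (V * V'), (V' * W + V * W'); split; first exact: mulf_neq0.
  rewrite actpDr {1}mulrC !actpM VW VW' !actp_coef.
  by apply/funext => m; rewrite coefD.
move=> t; rewrite hornerM mulf_eq0 negb_or => /andP[Vt Vt'].
by rewrite FE // GE // !hornerE; field; rewrite Vt Vt'.
Qed.

Lemma generatesZ a x F : generates x F ->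
  generates (fun m => a * x m) (fun t => a * F t).
Proof.
move=> [V [W [V0 VW FE]]]; exists V, (a *: W); split => //.
  by rewrite actpZr VW; apply/funext => m; rewrite coefZ.
by move=> t Vt; rewrite FE // hornerZ mulrA.
Qed.

Lemma generates0 : generates (fun=> 0) (fun=> 0).
Proof.
exists 1, 0; split; rewrite ?oner_neq0 //.
  by apply/funext => m; rewrite /actp big1 ?coef0 // => k _; rewrite mulr0.
by move=> t _; rewrite horner0 mul0r.
Qed.

Lemma generates_sum (I : Type) (s : seq I) (x : I -> nat -> C) (F : I -> C -> C) :
  (forall i, generates (x i) (F i)) ->
  generates (fun m => \sum_(i <- s) x i m) (fun t => \sum_(i <- s) F i t).
Proof.
move=> xF; elim: s => [|i s IH].
  under eq_fun do rewrite big_nil; under [X in generates _ X]eq_fun do rewrite big_nil.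
  exact: generates0.
under eq_fun do rewrite big_cons; under [X in generates _ X]eq_fun do rewrite big_cons.
exact: generatesD.
Qed.

Lemma generates_shift M x F : generates x F ->
  generates (fun m => if (m < M)%N then 0 else x (m - M)%N) (fun t => t ^+ M * F t).
Proof.
move=> [V [W [V0 VW FE]]]; exists V, ('X^M * W); split => //.
  have -> : (fun m => if (m < M)%N then 0 else x (m - M)%N) = actp 'X^M x.
    by apply/funext => m; rewrite actpXn.
  by rewrite actpC VW actp_coef.
by move=> t Vt; rewrite FE // hornerM hornerXn mulrA.
Qed.

(** The form of [dominated_partial_sums] that does not mention numerators
    and denominators. *)
Lemma generates_bounded x F : generates x F ->
  (forall b, b != 0 -> normc b <= 1 -> bounded_near0 (fun u => F (radial b u))) ->
  exists K : R, forall m, \sum_(i < m) normc (x i) <= K.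
Proof.
move=> [V [W [V0 VW FE]]] bF; apply: (dominated_partial_sums V0 VW).
move=> b b0 b1; have [K KP] := bF b b0 b1; exists K; near=> u.
have Vu : V.[radial b u] != 0 by near: u; exact: horner_radial_neq0.
have Fu : normc (F (radial b u)) <= K by near: u.
rewrite -ler_pdivrMr ?normc_gt0 // -Normc.normcV -Normc.normcM -FE //.
Unshelve. all: by end_near. Qed.

Lemma map_eulerp n : map_poly (real_complex R) (eulerp R n) = eulerp C n.
Proof.
elim: n => [|n IH] /=; first by rewrite rmorph1.
rewrite map_polyZ !(rmorphM, rmorphD, rmorphN, rmorph1) /= map_polyX.
by rewrite map_polyZ -deriv_map IH fmorphV !rmorph_nat.
Qed.

Definition power_seq g n (m : nat) : C := g ^+ m * (m%:R ^+ n / n`!%:R).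
Definition power_gen g n t : C := (eulerp C n).[g * t] / (1 - g * t) ^+ n.+1.

Lemma generates_power g n : generates (power_seq g n) (power_gen g n).
Proof.
exists ((1 - 'X) ^+ n.+1 \Po (g *: 'X)), (eulerp C n \Po (g *: 'X)); split.
- apply/eqP => /(congr1 (horner^~ 0)) /eqP; rewrite /= horner_comp horner0.
  by rewrite hornerZ hornerX mulr0 horner_exp !hornerE subr0 expr1n oner_eq0.
- rewrite /power_seq actp_scale actp_eulerp.
  by apply/funext => m; rewrite coef_comp_scale mulrC.
- by move=> t _; rewrite /power_gen !horner_comp horner_exp !hornerE.
Qed.

(** The polar part of [sum_m (t/b)^m m^n/n!] at [t = b e^-u] is
    [u^-(n+1)], by [eulerp_bounded]. *)
Lemma power_gen_bounded b n :
  b != 0 -> bounded_near0 (fun u => power_gen b^-1 n (radial b u) - (u ^- n.+1)%:C).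
Proof.
move=> b0; have [c c0 cP] := @eulerp_bounded R n; exists c; near=> u.
have u0 : 0 < u by near: u; exact: nbhs_right_gt.
have u1 : u <= 1 by near: u; exact: nbhs_right_le.
have := cP u; rewrite u0 u1 => /(_ isT); rewrite -normc_real.
rewrite rmorphB rmorphM fmorphV rmorphXn rmorphB rmorph1 /=.
by rewrite -horner_map map_eulerp /power_gen /radial mulKf.
Unshelve. all: by end_near. Qed.

Lemma power_gen_bounded_neq g b n : g * b != 1 ->
  bounded_near0 (fun u => power_gen g n (radial b u)).
Proof.
move=> gb; have e t : (1 - g *: 'X : {poly C}).[t] = 1 - g * t by rewrite !hornerE.
have Et t : (eulerp C n).[g * t] = (eulerp C n \Po (g *: 'X)).[t].
  by rewrite horner_comp hornerZ hornerX.
have h : ((1 - g *: 'X) ^+ n.+1 : {poly C}).[b] != 0.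
  by rewrite horner_exp e expf_neq0 // subr_eq0 eq_sym.
under eq_fun do rewrite /power_gen Et -e -horner_exp.
by apply: bounded_near0M; [exact: bounded_near0_horner|exact: bounded_near0_hornerV].
Qed.

End Generating.

(** * The error term *)

Section Assembly.
Variable R : realType.
Local Notation C := R[i].
Local Notation normc := (@Normc.normc R).
Variable alpha : R.
Hypothesis alpha_gt1 : 1 < alpha.
Variables P Q : {poly C}.
Hypothesis Q0 : Q != 0.
Let f (s : C) := P.[cpow alpha (- s)] / Q.[cpow alpha (- s)].

Lemma poles_in_strip a : poles alpha f a <-> is_pole f a /\ in_strip alpha a.
Proof. by split => [[p r i]|[p [r i]]]; split. Qed.

(** [a |-> alpha^-a] maps the poles of the strip injectively to zeros of
    [Q]. *)
Lemma finite_poles : finite_set (poles alpha f).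
Proof.
pose base a := cpow alpha (- a).
have inj : {in poles alpha f &, injective base}.
  move=> a1 a2; rewrite !inE => /poles_in_strip[_ h1] /poles_in_strip[_ h2].
  exact: strip_inj.
rewrite -(eq_finite_set (inj_card_eq inj)).
have [rs QE] := closed_field_poly_normal Q.
apply: (@sub_finite_set _ _ [set` rs]); last exact: finite_seq.
move=> _ [a /poles_in_strip[pa _] <-] /=; have := pole_root alpha_gt1 pa.
by rewrite QE rootZ ?lead_coef_eq0 // root_prod_XsubC.
Qed.

Variables (N : C -> nat) (c : nat -> C -> C).
Hypothesis lau : forall a, poles alpha f a -> laurent_at alpha f a (N a) (c ^~ a).

(** Contribution of the pole [a] to the number of points of height
    [alpha^m]. *)
Definition pole_seq a (m : nat) : C :=
  cpow alpha (a * m%:R) *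
    (\sum_(1 <= n < (N a).+1) c n a * (m%:R ^+ n.-1 / (n.-1)`!%:R)).

Definition pole_gen a t : C :=
  \sum_(1 <= n < (N a).+1) c n a * power_gen (cpow alpha (- a))^-1 n.-1 t.

Lemma generates_pole a : generates (pole_seq a) (pole_gen a).
Proof.
have -> : pole_seq a = fun m =>
    \sum_(1 <= n < (N a).+1) c n a * power_seq (cpow alpha (- a))^-1 n.-1 m.
  apply/funext => m; rewrite /pole_seq mulr_sumr; apply: eq_bigr => n _.
  rewrite mulrCA /power_seq; congr (_ * (_ * _)).
  rewrite /cpow mulNr mulrAC cexpMn; congr (_ ^+ m).
  apply: (mulIf (cexp_neq0 (- (a * (ln alpha)%:C)))).
  by rewrite mulVf ?cexp_neq0 // -cexpD subrr cexp0.
apply: generates_sum => n; apply: generatesZ; exact: generates_power.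
Qed.

Lemma pole_gen_bounded a b : cpow alpha (- a) != b ->
  bounded_near0 (fun u => pole_gen a (radial b u)).
Proof.
move=> ab; apply: bounded_near0_sum => n; apply: bounded_near0M.
  exact: bounded_near0_cst.
apply: power_gen_bounded_neq; apply: contra ab => /eqP e; apply/eqP.
have a0 : cpow alpha (- a) != 0 by exact: cexp_neq0.
by rewrite -[LHS]mulr1 -e mulVKf.
Qed.

(** Both [P/Q] and [pole_gen a] have polar part [sum_n c_n / u^n]. *)
Lemma polar_part_bounded a : poles alpha f a ->
  let b := cpow alpha (- a) in
  bounded_near0 (fun u =>
    P.[radial b u] / Q.[radial b u] - pole_gen a (radial b u)).
Proof.
move=> pa b.
have b0 : b != 0 by exact: cexp_neq0.
have h1 := laurent_bounded alpha_gt1 (lau pa).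
have h2 : bounded_near0 (fun u => \sum_(1 <= n < (N a).+1)
    c n a * (power_gen b^-1 n.-1 (radial b u) - (u ^- n.-1.+1)%:C)).
  apply: bounded_near0_sum => n; apply: bounded_near0M; first exact: bounded_near0_cst.
  exact: power_gen_bounded.
apply: near_eq_bounded_near0 (bounded_near0D h1 (bounded_near0N h2)).
near=> u; rewrite -/b -addrA; congr (_ + _).
rewrite -opprD; congr (- _); rewrite -big_split /= /pole_gen.
rewrite big_nat_cond [RHS]big_nat_cond.
apply: eq_bigr => n /andP[/andP[n0 _] _]; rewrite prednK // -/b; ring.
Unshelve. all: by end_near. Qed.

Let ps := fset_set (poles alpha f).

Lemma mem_pole_fset a : (a \in ps) <-> poles alpha f a.
Proof. by rewrite in_fset_set ?inE //; exact: finite_poles. Qed.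

(** Each [b] is [alpha^-a] for a unique [a] in the strip.  If [a] is a pole
    then its own generating function cancels the polar part; those of the
    other poles are regular at [b], being singular only at
    [alpha^-a' <> b]. *)
Lemma remainder_bounded b : b != 0 -> normc b <= 1 ->
  bounded_near0 (fun u => P.[radial b u] / Q.[radial b u]
    - \sum_(a <- ps) pole_gen a (radial b u)).
Proof.
move=> b0 b1; have [a astrip ab] := strip_surj alpha_gt1 b0 b1.
have others (s : seq C) : a \notin s -> {subset s <= ps} ->
    bounded_near0 (fun u => \sum_(a' <- s) pole_gen a' (radial b u)).
  elim: s => [|a' s IH].
    by move=> _ _; under eq_fun do rewrite big_nil; exact: bounded_near0_cst.
  rewrite inE negb_or => /andP[aa' as_] sub.
  under eq_fun do rewrite big_cons.
  apply: bounded_near0D; last first.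
    by apply: IH => // x xs; apply: sub; rewrite inE xs orbT.
  apply: pole_gen_bounded; apply: contra aa' => /eqP e; apply/eqP.
  have /mem_pole_fset/poles_in_strip[_ h] := sub a' (mem_head _ _).
  by apply: (strip_inj alpha_gt1) => //; rewrite ab e.
have [aps|aps] := boolP (a \in ps); last first.
  apply: bounded_near0D; last by apply: bounded_near0N; exact: others.
  rewrite -ab; apply: not_pole_bounded => // pa; case/negP: aps.
  by apply/mem_pole_fset/poles_in_strip.
have /mem_pole_fset pa := aps.
have := polar_part_bounded pa; rewrite ab => h1.
have h2 : bounded_near0 (fun u => \sum_(a' <- rem a ps) pole_gen a' (radial b u)).
  by apply: others => [|x]; [rewrite mem_rem_uniqF ?fset_uniq|exact: mem_rem].
apply: near_eq_bounded_near0 (bounded_near0D h1 (bounded_near0N h2)).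
by near=> u; rewrite (big_rem _ aps) /= opprD addrA.
Unshelve. all: by end_near. Qed.

(** The generating function of the difference, [t^M (P/Q - sum_a G_a)], is
    bounded near every nonzero point of the closed unit disc, so the
    difference is absolutely summable. *)
Lemma bounded_sum_error M (x : nat -> C) :
  actp Q x = (fun m => ('X^M * P)`_m) ->
  exists K : R, forall l, normc (\sum_(i < M + l) x i
     - \sum_(m < l) \sum_(a <- ps) pole_seq a m) <= K.
Proof.
move=> xQ.
have gx : generates x (fun t => t ^+ M * (P.[t] / Q.[t])).
  exists Q, ('X^M * P); split => //.
  by move=> t _; rewrite hornerM hornerXn mulrA.
have ge : generates (fun m => \sum_(a <- ps) pole_seq a m)
    (fun t => \sum_(a <- ps) pole_gen a t).
  by apply: generates_sum => a; exact: generates_pole.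
have g := generatesD gx (generatesZ (-1) (generates_shift M ge)).
have [|K KP] := generates_bounded g.
  move=> b b0 b1; have h := remainder_bounded b0 b1.
  have h' : bounded_near0 (fun u => ('X^M).[radial b u] *
      (P.[radial b u] / Q.[radial b u] - \sum_(a <- ps) pole_gen a (radial b u))).
    by apply: bounded_near0M => //; exact: bounded_near0_horner.
  apply: near_eq_bounded_near0 h'; near=> u; rewrite hornerXn; ring.
exists K => l; rewrite (le_trans _ (KP (M + l)%N)) //.
rewrite (le_trans _ (normc_sum _ _ _)) // big_split /= -mulr_sumr mulN1r.
have -> : \sum_(i < M + l)
    (if (i < M)%N then 0 else \sum_(a <- ps) pole_seq a (i - M)) =
    \sum_(m < l) \sum_(a <- ps) pole_seq a m.
  rewrite big_split_ord /= big1 ?add0r => [|i _]; last by rewrite ltn_ord.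
  by apply: eq_bigr => i _; rewrite ltnNge leq_addr /= addKn.
exact: lexx.
Unshelve. all: by end_near. Qed.

End Assembly.

Theorem theorem1p2 (R : realType) (S : choiceType) (H : S -> R)
    (Hpos : forall x : S, 0 < H x)
    (Hfin : forall B : R, 0 < B -> finite_set [set x : S | H x <= B])
    (Zcvg : exists sigma : R, forall s : R[i],
      sigma < complex.Re s -> zeta_abs_cvg H s)
    (alpha : R) (alpha_gt1 : 1 < alpha)
    (P Q : {poly rat}) (Q_neq0 : Q != 0)
    (Zrat : exists sigma : R, forall s : R[i],
      sigma < complex.Re s -> zeta H s = ratfun alpha P Q s)
    (N : R[i] -> nat) (c : nat -> R[i] -> R[i])
    (Zlaurent : forall a : R[i], poles alpha (ratfun alpha P Q) a ->
      laurent_at alpha (ratfun alpha P Q) a (N a) (c ^~ a)) :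
  finite_set (poles alpha (ratfun alpha P Q)) /\
  exists K : R, \forall B \near +oo,
    Normc.normc
      ((counting_fun H B)%:R
       - \sum_(m \in [set m : nat | alpha ^+ m <= B])
           \sum_(a \in poles alpha (ratfun alpha P Q))
             cpow alpha (a * m%:R) *
             (\sum_(1 <= n < (N a).+1)
                c n a * (m%:R ^+ n.-1 / (n.-1)`!%:R))) <= K.
Proof.
pose PC : {poly R[i]} := map_poly ratr P; pose QC : {poly R[i]} := map_poly ratr Q.
have QC0 : QC != 0 by rewrite map_poly_eq0.
have finP := finite_poles alpha_gt1 PC QC0.
split; first exact: finP.
have [s1 cv] := Zcvg; have [s2 zE] := Zrat.
pose n0 := Num.bound (Num.max `|s1| `|s2|).
have n0P n : (n0 <= n)%N -> s1 < n%:R /\ s2 < n%:R.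
  move=> h; have : Num.max `|s1| `|s2| < n%:R.
    rewrite (lt_le_trans (archi_boundP _)) ?ler_nat // le_max normr_ge0 //.
  by rewrite gt_max => /andP[h1 h2]; split; apply: le_lt_trans (ler_norm _) _.
have ReN n : complex.Re (n%:R : R[i]) = n%:R.
  by rewrite -(rmorph_nat (real_complex R)).
have cvn n : (n0 <= n)%N -> zeta_abs_cvg H n%:R.
  by move=> /n0P[h _]; apply: cv; rewrite ReN.
have a0 : 0 < alpha by rewrite (lt_trans ltr01).
have zEn n : (n0 <= n)%N -> zeta H n%:R = PC.[(alpha ^- n)%:C] / QC.[(alpha ^- n)%:C].
  by move=> /n0P[_ h]; rewrite zE ?ReN // /ratfun cpow_opp_nat.
have rec := level_card_recurrence Hpos Hfin alpha_gt1 QC0 cvn zEn.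
have [M MP] := height_lower_bound Hpos Hfin alpha_gt1 1.
have lev := actp_level_seq alpha_gt1 QC0 rec MP.
have [K KP] := bounded_sum_error alpha_gt1 QC0 Zlaurent lev.
exists K; near=> B.
have B1 : 1 <= B by near: B; exact: nbhs_pinfty_ge.
have [l lB] : exists l, alpha ^+ l <= B < alpha ^+ l.+1.
  have [n nP] := expr_unbounded B alpha_gt1.
  have ex : exists n, B < alpha ^+ n by exists n; exact: nP.
  case: (ex_minnP ex) => -[|l] Bl lmin; first by move: Bl; rewrite expr0 ltNge B1.
  exists l; rewrite Bl andbT leNgt; apply/negP => /lmin; by rewrite ltnn.
rewrite (counting_fun_level_sum Hpos Hfin alpha_gt1 QC0 rec MP lB).
have /andP[lB1 lB2] := lB.
have -> : [set m : nat | alpha ^+ m <= B] = `I_l.+1.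
  apply/seteqP; split => m /=.
    by move=> mB; rewrite -(ltr_eXn2l alpha_gt1) (le_lt_trans mB).
  by rewrite ltnS => ml; rewrite (le_trans _ lB1) // ler_eXn2l.
rewrite -fsbig_ord.
under [X in Normc.normc (_ - X)]eq_bigr do rewrite (fsbig_finite _ _ finP).
exact: KP.
Unshelve. all: by end_near. Qed.
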